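(* Let $\mathrm{T}$ be a complete theory of unital $\mathrm{C}^*$-algebras such that every model $A$ of $\mathrm{T}$ satisfies the following conditions: (a) for all $p, q \in \mathcal{P}(A)$, $pq = qp$; (b) $A$ has no minimal projections, i.e. for every $p \in \mathcal{P}(A) \setminus \{0\}$ there exists $q \in \mathcal{P}(A)$ with $0 \lneq q \lneq p$. Then, if the continuum hypothesis fails (i.e. $\aleph_1 < 2^{\aleph_0}$), there exist unital $\mathrm{C}^*$-algebras $A, B \models \mathrm{T}$ with density characters at most $2^{\aleph_0}$ such that $A^{\mathcal{U}} \not\cong B^{\mathcal{V}}$ for all non-principal ultrafilters $\mathcal{U}, \mathcal{V}$ on $\omega$.
   Context: For a $\mathrm{C}^*$-algebra $A$, $\mathcal{P}(A)$ denotes the set of projections of $A$ (elements $p$ with $p = p^* = p^2$), with the usual order. Unital $\mathrm{C}^*$-algebras are assumed to satisfy $1 \ne 0$. The density character of a metric space is the least cardinality of a dense subset. Unital $\mathrm{C}^*$-algebras are regarded as metric structures in continuous logic in the usual way: quantifiers range over norm-closed balls; terms are complex $*$-polynomials (with the constant $1$); atomic formulas are norms $\|t(\bar x)\|$ of terms; formulas are built from atomic formulas by continuous functions $\mathbb{R}^n\to\mathbb{R}$ and the quantifiers $\sup$ and $\inf$ over balls. The value $0$ plays the role of ''true'': a theory $\mathrm{T}$ is a set of sentences, and $M \models \mathrm{T}$ means $\sigma^M = 0$ for all $\sigma\in \mathrm{T}$. A theory of unital $\mathrm{C}^*$-algebras is one all of whose models are unital $\mathrm{C}^*$-algebras. $\mathrm{T}$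 is complete if it has a model and any two models assign the same value to every sentence. For an ultrafilter $\mathcal{U}$ on $\omega$, $A^{\mathcal{U}} = \ell^\infty(\omega, A)/\{(a_n)_n : \lim_{n\to\mathcal{U}} \|a_n\| = 0\}$. $\cong$ is $*$-isomorphism. *)

(* Defs.v *)
From HB Require Import structures.
From mathcomp Require Import all_boot all_order all_algebra.
From mathcomp Require Import ring_quotient complex.
From mathcomp Require Import all_classical all_reals all_analysis.

Set Implicit Arguments.
Unset Strict Implicit.
Unset Printing Implicit Defensive.

Import Order.TTheory GRing.Theory Num.Theory numFieldNormedType.Exports.

Local Open Scope classical_set_scope.
Local Open Scope card_scope.
Local Open Scope quotient_scope.
Local Open Scope ring_scope.

HB.mixin Record Algebra_hasStar (C : numClosedFieldType) A
    & GRing.Algebra C A := {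
  star : A -> A;
  starK : involutive star;
  starD : {morph star : x y / x + y};
  starZ : forall (a : C) (x : A), star (a *: x) = a^* *: star x;
  starM : forall x y : A, star (x * y) = star y * star x
}.

#[short(type="starAlgType")]
HB.structure Definition StarAlgebra (C : numClosedFieldType) :=
  {A of GRing.Algebra C A & Algebra_hasStar C A}.

Definition cauchy_complete (R : realType) (T : Type) (d : T -> T -> R) :=
  forall u : nat -> T,
    (forall e : R, 0 < e -> exists N, forall m n,
       (N <= m)%N -> (N <= n)%N -> d (u m) (u n) < e) ->
    exists l, d (u n) l @[n --> \oo] --> (0 : R).

(* Unital C*-algebras. The real-valued norm is a field of the mixin, because
   Hierarchy Builder rejects a join of GRing.Algebra and NormedModule lying above
   Num.NumDomain. The condition 1 != 0 is part of GRing.NzRing. *)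
HB.mixin Record isCStar (R : realType) A & StarAlgebra R[i] A := {
  cnorm : A -> R;
  cnorm_ge0 : forall x, 0 <= cnorm x;
  cnorm0_eq0 : forall x, cnorm x = 0 -> x = 0;
  cnormD : forall x y, cnorm (x + y) <= cnorm x + cnorm y;
  cnormZ : forall (a : R[i]) x, cnorm (a *: x) = complex.Re `|a| * cnorm x;
  cnormM : forall x y, cnorm (x * y) <= cnorm x * cnorm y;
  cstar_identity : forall x, cnorm (star x * x) = cnorm x ^+ 2;
  cnorm_complete : cauchy_complete (fun x y => cnorm (x - y))
}.

#[short(type="cstarAlgType")]
HB.structure Definition CStarAlgebra (R : realType) :=
  {A of StarAlgebra R[i] A & isCStar R A}.


Lemma starB {C : numClosedFieldType} {A : starAlgType C} (x y : A) :
  star (x - y) = star x - star y.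
Proof. by rewrite starD -scaleN1r starZ rmorphN1 scaleN1r. Qed.

Section CNormTheory.
Context {R : realType} {A : cstarAlgType R}.
Implicit Types x y : A.

Lemma cnorm0 : cnorm (0 : A) = 0.
Proof. by rewrite -(scale0r (0 : A)) cnormZ normr0 mul0r. Qed.

Lemma cnormN x : cnorm (- x) = cnorm x.
Proof. by rewrite -scaleN1r cnormZ normrN1 mul1r. Qed.

Lemma cnormB x y : cnorm (x - y) <= cnorm x + cnorm y.
Proof. by rewrite -(cnormN y) cnormD. Qed.

Lemma cnorm_distC x y : cnorm (x - y) = cnorm (y - x).
Proof. by rewrite -opprB cnormN. Qed.

Lemma cnorm_distD x y z : cnorm (x - z) <= cnorm (x - y) + cnorm (y - z).
Proof. by rewrite -{1}(subrK y x) -addrA cnormD. Qed.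

Lemma cnorm_star x : cnorm (star x) = cnorm x.
Proof.
suff h y : cnorm y <= cnorm (star y).
  by apply/eqP; rewrite eq_le -{2}(starK x) !h.
have := cnorm_ge0 y; rewrite le_eqVlt => /predU1P[<-|y0]; first exact: cnorm_ge0.
by rewrite -(ler_pM2r y0) -expr2 -cstar_identity cnormM.
Qed.

Lemma cnorm1 : cnorm (1 : A) = 1.
Proof.
have n0 : cnorm (1 : A) != 0.
  by apply/eqP => /cnorm0_eq0/eqP; rewrite oner_eq0.
apply: (mulfI n0); rewrite mulr1 -expr2 -cstar_identity mulr1.
by rewrite cnorm_star.
Qed.

End CNormTheory.

Definition is_projection {R : realType} {A : cstarAlgType R} (p : A) :=
  star p = p /\ p * p = p.

(* For projections, p * q = p iff q - p is positive. *)
Definition proj_le {R : realType} {A : cstarAlgType R} (p q : A) := p * q = p.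

Definition proj_lt {R : realType} {A : cstarAlgType R} (p q : A) :=
  proj_le p q /\ p <> q.

Definition star_isomorphic {C : numClosedFieldType} (A B : starAlgType C) :=
  exists f : {lrmorphism A -> B},
    bijective f /\ forall x, f (star x) = star (f x).

(* The density character of A is at most the cardinality of K. *)
Definition density_character_le {R : realType} (A : cstarAlgType R) (K : Type) :=
  exists D : set A,
    (forall (x : A) (e : R), 0 < e -> exists2 y, D y & cnorm (x - y) < e) /\
    D #<= [set: K].

(* Its negation says that some cardinal lies strictly between aleph_0 and
   2^aleph_0, that is, aleph_1 < 2^aleph_0. *)
Definition continuum_hypothesis :=
  forall X : set (set nat), countable X \/ X #= [set: set nat].

Definition nonprincipal (U : set_system nat) := forall n, ~ U [set n].

Section FunAlgebra.
Context {C : numClosedFieldType} {T : pointedType} {A : algType C}.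

Fact fct_scalerAl (a : C) (f g : T -> A) : a *: (f * g) = (a *: f) * g.
Proof. by apply/funext => t; rewrite /GRing.scale/= /GRing.mul/= scalerAl. Qed.
HB.instance Definition _ := GRing.Lmodule_isLalgebra.Build C (T -> A) fct_scalerAl.

Fact fct_scalerAr (a : C) (f g : T -> A) : a *: (f * g) = f * (a *: g).
Proof. by apply/funext => t; rewrite /GRing.scale/= /GRing.mul/= scalerAr. Qed.
HB.instance Definition _ := GRing.Lalgebra_isAlgebra.Build C (T -> A) fct_scalerAr.
End FunAlgebra.

Section Linf.
Context {R : realType} (A : cstarAlgType R).

Definition linf_pred : {pred nat -> A} :=
  [pred a | `[< exists M : R, forall n, cnorm (a n) <= M >]].

Fact linf_subalg_closed : subalg_closed linf_pred.
Proof.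
split.
- by apply/asboolP; exists 1 => n; rewrite cnorm1.
- move=> k a b /asboolP[M aM] /asboolP[N bN]; apply/asboolP.
  exists (complex.Re `|k| * M + N) => n.
  rewrite (le_trans (cnormD _ _))// lerD// cnormZ ler_wpM2l//.
  by have := normr_ge0 k; rewrite lecE => /andP[].
- move=> a b /asboolP[M aM] /asboolP[N bN]; apply/asboolP.
  exists (M * N) => n.
  by rewrite (le_trans (cnormM _ _))// ler_pM// cnorm_ge0.
Qed.
HB.instance Definition _ :=
  GRing.isSubalgClosed.Build R[i] (nat -> A) linf_pred linf_subalg_closed.

Record linf := Linf { linf_val :> nat -> A; _ : linf_val \in linf_pred }.
HB.instance Definition _ := [isSub for linf_val].
HB.instance Definition _ := [Choice of linf by <:].
HB.instance Definition _ := [SubChoice_isSubAlgebra of linf by <:].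

Lemma linf_starP (a : linf) : (fun n => star (a n)) \in linf_pred.
Proof.
case: a => a /= /asboolP[M aM]; apply/asboolP; exists M => n.
by rewrite cnorm_star.
Qed.
Definition linf_star (a : linf) : linf := Linf (linf_starP a).

Fact linf_starK : involutive linf_star.
Proof. by move=> a; apply/val_inj/funext => n /=; rewrite starK. Qed.
Fact linf_starD : {morph linf_star : x y / x + y}.
Proof. by move=> a b; apply/val_inj/funext => n /=; rewrite starD. Qed.
Fact linf_starZ (k : R[i]) a : linf_star (k *: a) = k^* *: linf_star a.
Proof. by apply/val_inj/funext => n /=; rewrite starZ. Qed.
Fact linf_starM a b : linf_star (a * b) = linf_star b * linf_star a.
Proof. by apply/val_inj/funext => n /=; rewrite starM. Qed.
HB.instance Definition _ := Algebra_hasStar.Build R[i] linf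
  linf_starK linf_starD linf_starZ linf_starM.

End Linf.

Section Ultrapower.
Context {R : realType} (A : cstarAlgType R).
Context (U : set_system nat) {FU : UltraFilter U}.

Definition null_pred : {pred linf A} :=
  [pred a : linf A | `[< cnorm (a n) @[n --> U] --> (0 : R) >]].

Lemma null_le (u : nat -> R) (a : linf A) :
  (forall n, cnorm (a n) <= u n) -> u n @[n --> U] --> (0 : R) ->
  a \in null_pred.
Proof.
move=> au u0; apply/asboolP.
apply: (@squeeze_cvgr _ _ _ _ (fun=> 0) u) => //; last exact: cvg_cst.
by apply: nearW => n; rewrite cnorm_ge0 au.
Qed.

Fact null_zmod_closed : zmod_closed null_pred.
Proof.
split.
  apply: (@null_le (fun=> 0)); last exact: cvg_cst.
  by move=> n; rewrite cnorm0.
move=> a b /asboolP a0 /asboolP b0.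
apply: (@null_le (fun n => cnorm (a n) + cnorm (b n))) => [n|].
  exact: cnormB.
by rewrite -(addr0 0); exact: cvgD.
Qed.
HB.instance Definition _ :=
  GRing.isZmodClosed.Build (linf A) null_pred null_zmod_closed.

Lemma null_mulr (a b : linf A) : a \in null_pred -> a * b \in null_pred.
Proof.
move=> /asboolP a0; have /asboolP[M bM] := valP b.
apply: (@null_le (fun n => cnorm (a n) * M)) => [n|].
  by rewrite (le_trans (cnormM _ _))// ler_wpM2l ?cnorm_ge0.
by rewrite -(mul0r M); apply: cvgM => //; exact: cvg_cst.
Qed.

Lemma null_mull (a b : linf A) : b \in null_pred -> a * b \in null_pred.
Proof.
move=> /asboolP b0; have /asboolP[M aM] := valP a.
apply: (@null_le (fun n => M * cnorm (b n))) => [n|].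
  by rewrite (le_trans (cnormM _ _))// ler_wpM2r ?cnorm_ge0.
by rewrite -(mulr0 M); apply: cvgM => //; exact: cvg_cst.
Qed.

Lemma null_scale (k : R[i]) (a : linf A) :
  a \in null_pred -> k *: a \in null_pred.
Proof. by move=> a0; rewrite -[a]mul1r scalerAl null_mull. Qed.

Lemma null_star (a : linf A) : a \in null_pred -> star a \in null_pred.
Proof.
by move=> /asboolP a0; apply: null_le a0 => n; rewrite cnorm_star.
Qed.

Lemma null_one : 1 \notin null_pred.
Proof.
apply/negP => /asboolP h.
have h1 : cst (1 : R) n @[n --> U] --> (0 : R).
  by move: h; under eq_fun do rewrite cnorm1.
have /eqP : (0 : R) = 1 by exact: norm_cvg_unique h1 (cvg_cst _).
by rewrite eq_sym oner_eq0.
Qed.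

(* {ideal_quot I} is only the quotient group here, as linf A is not commutative;
   the *-algebra operations are induced below. *)
Definition ultrapower : Type := {ideal_quot null_pred}.
HB.instance Definition _ := GRing.Zmodule.on ultrapower.
HB.instance Definition _ := EqQuotient.on ultrapower.

Definition up_class (a : linf A) : ultrapower := \pi_ultrapower a.

Lemma up_classP (a b : linf A) :
  reflect (up_class a = up_class b) (a - b \in null_pred).
Proof. by rewrite Quotient.idealrBE; exact: eqP. Qed.

Lemma up_classW (P : ultrapower -> Prop) :
  (forall a, P (up_class a)) -> forall x, P x.
Proof. by move=> h x; rewrite -[x]reprK; exact: h. Qed.

Lemma up_classD (a b : linf A) : up_class (a + b) = up_class a + up_class b.
Proof. by rewrite /up_class piE. Qed.

Lemma sub_repr (a : linf A) : a - repr (up_class a) \in null_pred.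
Proof. by apply/up_classP; rewrite /up_class reprK. Qed.

Definition up_mul (x y : ultrapower) : ultrapower := up_class (repr x * repr y).
Definition up_scale (k : R[i]) (x : ultrapower) : ultrapower :=
  up_class (k *: repr x).
Definition up_star (x : ultrapower) : ultrapower := up_class (star (repr x)).

Fact up_mulE (a b : linf A) :
  up_mul (up_class a) (up_class b) = up_class (a * b).
Proof.
apply/esym/up_classP.
rewrite -[a * b](subrK (a * repr (up_class b))) -mulrBr -addrA -mulrBl.
exact: rpredD (null_mull _ (sub_repr _)) (null_mulr _ (sub_repr _)).
Qed.

Fact up_scaleE (k : R[i]) (a : linf A) :
  up_scale k (up_class a) = up_class (k *: a).
Proof. by apply/esym/up_classP; rewrite -scalerBr null_scale// sub_repr. Qed.

Fact up_starE (a : linf A) :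
  up_star (up_class a) = up_class (star a).
Proof. by apply/esym/up_classP; rewrite -starB null_star// sub_repr. Qed.

Let up_classD (a b : linf A) :
  up_class (a + b) = up_class a + up_class b.
Proof. by rewrite /up_class piE. Qed.

Fact up_mulA : associative up_mul.
Proof.
by elim/up_classW=> a; elim/up_classW=> b; elim/up_classW=> c; rewrite !up_mulE mulrA.
Qed.
Fact up_mul1 : left_id (up_class 1) up_mul.
Proof. by elim/up_classW=> a; rewrite up_mulE mul1r. Qed.
Fact up_1mul : right_id (up_class 1) up_mul.
Proof. by elim/up_classW=> a; rewrite up_mulE mulr1. Qed.
Fact up_mulDl : left_distributive up_mul +%R.
Proof.
elim/up_classW=> a; elim/up_classW=> b; elim/up_classW=> c.
by rewrite -up_classD !up_mulE mulrDl up_classD.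
Qed.
Fact up_mulDr : right_distributive up_mul +%R.
Proof.
elim/up_classW=> a; elim/up_classW=> b; elim/up_classW=> c.
by rewrite -up_classD !up_mulE mulrDr up_classD.
Qed.
Fact up_oner_neq0 : up_class 1 != 0 :> ultrapower.
Proof.
have <- : up_class 0 = 0 :> ultrapower by rewrite /up_class piE.
by apply/negP => /eqP/up_classP; rewrite subr0; apply/negP; exact: null_one.
Qed.
HB.instance Definition _ := GRing.Zmodule_isNzRing.Build ultrapower
  up_mulA up_mul1 up_1mul up_mulDl up_mulDr up_oner_neq0.

Fact up_scaleA (k l : R[i]) x : up_scale k (up_scale l x) = up_scale (k * l) x.
Proof. elim/up_classW: x => a.
by rewrite !up_scaleE scalerA. Qed.
Fact up_scale1 : left_id 1 up_scale.
Proof. by elim/up_classW=> a; rewrite up_scaleE scale1r. Qed.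
Fact up_scaleDr : right_distributive up_scale +%R.
Proof.
by move=> k; elim/up_classW=> a; elim/up_classW=> b; rewrite -up_classD !up_scaleE scalerDr up_classD.
Qed.
Fact up_scaleDl x : {morph up_scale^~ x : k l / k + l}.
Proof.
by elim/up_classW: x => a k l; rewrite !up_scaleE scalerDl up_classD.
Qed.
HB.instance Definition _ := GRing.Zmodule_isLmodule.Build R[i] ultrapower
  up_scaleA up_scale1 up_scaleDr up_scaleDl.

Fact up_scalerAl (k : R[i]) (x y : ultrapower) : k *: (x * y) = (k *: x) * y.
Proof.
elim/up_classW: x => a; elim/up_classW: y => b.
by rewrite /GRing.scale/= /GRing.mul/= !(up_mulE, up_scaleE) scalerAl.
Qed.
HB.instance Definition _ :=
  GRing.Lmodule_isLalgebra.Build R[i] ultrapower up_scalerAl.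

Fact up_scalerAr (k : R[i]) (x y : ultrapower) : k *: (x * y) = x * (k *: y).
Proof.
elim/up_classW: x => a; elim/up_classW: y => b.
by rewrite /GRing.scale/= /GRing.mul/= !(up_mulE, up_scaleE) scalerAr.
Qed.
HB.instance Definition _ :=
  GRing.Lalgebra_isAlgebra.Build R[i] ultrapower up_scalerAr.

Fact up_starK : involutive up_star.
Proof. by elim/up_classW=> a; rewrite !up_starE starK. Qed.
Fact up_starD : {morph up_star : x y / x + y}.
Proof.
by elim/up_classW=> a; elim/up_classW=> b; rewrite -up_classD !up_starE starD up_classD.
Qed.
Fact up_starZ (k : R[i]) (x : ultrapower) :
  up_star (k *: x) = k^* *: up_star x.
Proof.
elim/up_classW: x => a.
by rewrite /GRing.scale/= !(up_scaleE, up_starE) starZ.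
Qed.
Fact up_starM (x y : ultrapower) : up_star (x * y) = up_star y * up_star x.
Proof.
elim/up_classW: x => a; elim/up_classW: y => b.
by rewrite /GRing.mul/= !(up_mulE, up_starE) starM.
Qed.
HB.instance Definition _ := Algebra_hasStar.Build R[i] ultrapower
  up_starK up_starD up_starZ up_starM.

End Ultrapower.

Arguments ultrapower {R} A U {FU}.

(* A structure for the language of unital C*-algebras: a complete metric
   structure, with metric `|x + (-1) y| and quantification over the closed balls
   of lnorm, whose symbols obey the bounds and moduli of uniform continuity that
   the language prescribes. No identity of *-algebras is assumed, these have to
   come from the axioms of a theory. The bounds make the value of any formula
   bounded on balls, so that the suprema and infima in feval are the real ones. *)
Record lstructure (R : realType) := LStructure {
  lcar :> Type;
  lzero : lcar;
  lone : lcar;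
  ladd : lcar -> lcar -> lcar;
  lscale : R[i] -> lcar -> lcar;
  lmul : lcar -> lcar -> lcar;
  lstar : lcar -> lcar;
  lnorm : lcar -> R;
  ldist := fun x y => lnorm (ladd x (lscale (-1) y));
  ldist_eq0 : forall x y, ldist x y = 0 <-> x = y;
  ldist_sym : forall x y, ldist x y = ldist y x;
  ldist_triangle : forall x y z, ldist x z <= ldist x y + ldist y z;
  ldist_complete : cauchy_complete ldist;
  lnorm_ge0 : forall x, 0 <= lnorm x;
  lnorm_zero : lnorm lzero = 0;
  lnorm_one : lnorm lone <= 1;
  lnorm_add : forall x y, lnorm (ladd x y) <= lnorm x + lnorm y;
  lnorm_scale : forall a x, lnorm (lscale a x) <= complex.Re `|a| * lnorm x;
  lnorm_mul : forall x y, lnorm (lmul x y) <= lnorm x * lnorm y;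
  lnorm_star : forall x, lnorm (lstar x) <= lnorm x;
  lnorm_lip : forall x y, `|lnorm x - lnorm y| <= ldist x y;
  ladd_lip : forall x x' y y',
    ldist (ladd x y) (ladd x' y') <= ldist x x' + ldist y y';
  lscale_lip : forall a x y,
    ldist (lscale a x) (lscale a y) <= complex.Re `|a| * ldist x y;
  lmul_lip : forall r x x' y y',
    lnorm x <= r -> lnorm x' <= r -> lnorm y <= r -> lnorm y' <= r ->
    ldist (lmul x y) (lmul x' y') <= r * (ldist x x' + ldist y y');
  lstar_lip : forall x y, ldist (lstar x) (lstar y) <= ldist x y
}.

Definition lisomorphic {R : realType} (M N : lstructure R) :=
  exists f : M -> N, bijective f /\
    [/\ f (lzero M) = lzero N, f (lone M) = lone N,
        forall x, lnorm (f x) = lnorm x &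
        [/\ forall x y, f (ladd x y) = ladd (f x) (f y),
            forall x y, f (lmul x y) = lmul (f x) (f y),
            forall a x, f (lscale a x) = lscale a (f x) &
            forall x, f (lstar x) = lstar (f x)]].

Section StructureOfCStar.
Context {R : realType} (A : cstarAlgType R).

Let d (x y : A) := cnorm (x + (-1) *: y).
Let dE x y : d x y = cnorm (x - y). Proof. by rewrite /d scaleN1r. Qed.

Fact cdist_eq0 x y : d x y = 0 <-> x = y.
Proof.
rewrite dE; split => [/cnorm0_eq0/eqP|->]; last by rewrite subrr cnorm0.
by rewrite subr_eq0 => /eqP.
Qed.
Fact cdist_sym x y : d x y = d y x.
Proof. by rewrite !dE cnorm_distC. Qed.
Fact cdist_triangle x y z : d x z <= d x y + d y z.
Proof. by rewrite !dE cnorm_distD. Qed.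
Fact cdist_complete : cauchy_complete d.
Proof.
suff -> : d = fun x y => cnorm (x - y) by exact: cnorm_complete.
by apply/funext => x; apply/funext => y; rewrite dE.
Qed.
Fact cnorm_one_le : cnorm (1 : A) <= 1. Proof. by rewrite cnorm1. Qed.
Fact cnormZ_le (a : R[i]) (x : A) :
  cnorm (a *: x) <= complex.Re `|a| * cnorm x.
Proof. by rewrite cnormZ. Qed.
Fact cnorm_star_le (x : A) : cnorm (star x) <= cnorm x.
Proof. by rewrite cnorm_star. Qed.
Fact cnorm_lip x y : `|cnorm x - cnorm y| <= d x y.
Proof.
rewrite dE ler_norml lerNl opprB !lerBlDr; apply/andP; split.
  by rewrite cnorm_distC -{1}(subrK x y) cnormD.
by rewrite -{1}(subrK y x) cnormD.
Qed.
Fact cadd_lip x x' y y' : d (x + y) (x' + y') <= d x x' + d y y'.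
Proof. by rewrite !dE opprD addrACA cnormD. Qed.
Fact cscale_lip (a : R[i]) x y :
  d (a *: x) (a *: y) <= complex.Re `|a| * d x y.
Proof. by rewrite !dE -scalerBr cnormZ. Qed.
Fact cmul_lip r x x' y y' : cnorm x <= r -> cnorm x' <= r ->
  cnorm y <= r -> cnorm y' <= r -> d (x * y) (x' * y') <= r * (d x x' + d y y').
Proof.
move=> _ x'r yr _; rewrite !dE.
have -> : x * y - x' * y' = (x - x') * y + x' * (y - y').
  by rewrite mulrBl mulrBr addrA subrK.
rewrite (le_trans (cnormD _ _))// [leRHS]mulrDr lerD// (le_trans (cnormM _ _))//.
  by rewrite mulrC ler_wpM2r ?cnorm_ge0.
by rewrite ler_wpM2r ?cnorm_ge0.
Qed.
Fact cstar_lip x y : d (star x) (star y) <= d x y.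
Proof. by rewrite !dE -starB cnorm_star. Qed.

Definition lstructure_of : lstructure R :=
  LStructure cdist_eq0 cdist_sym cdist_triangle cdist_complete
    (@cnorm_ge0 R A) (@cnorm0 R A) cnorm_one_le (@cnormD R A) cnormZ_le
    (@cnormM R A) cnorm_star_le cnorm_lip cadd_lip cscale_lip cmul_lip
    cstar_lip.

End StructureOfCStar.

(* The terms and formulas below have free variables indexed by 'I_n. *)
Inductive lterm (R : realType) (n : nat) :=
| TVar of 'I_n
| TZero
| TOne
| TAdd of lterm R n & lterm R n
| TScale of R[i] & lterm R n
| TMul of lterm R n & lterm R n
| TStar of lterm R n.

(* In FSup r phi and FInf r phi the bound variable is variable 0 of phi, and
   ranges over the closed ball of radius r. *)
Inductive lformula (R : realType) : nat -> Type :=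
| FNorm n : lterm R n -> lformula R n
| FConn n k (f : 'rV[R]_k -> R) :
    continuous f -> ('I_k -> lformula R n) -> lformula R n
| FSup n : {posnum R} -> lformula R n.+1 -> lformula R n
| FInf n : {posnum R} -> lformula R n.+1 -> lformula R n.

Section Semantics.
Context {R : realType} (M : lstructure R).

Fixpoint teval n (t : lterm R n) (v : 'I_n -> M) : M :=
  match t with
  | TVar i => v i
  | TZero => lzero M
  | TOne => lone M
  | TAdd s t => ladd (teval s v) (teval t v)
  | TScale a t => lscale a (teval t v)
  | TMul s t => lmul (teval s v) (teval t v)
  | TStar t => lstar (teval t v)
  end.

Definition extend n (x : M) (v : 'I_n -> M) (i : 'I_n.+1) : M :=
  oapp v x (unlift ord0 i).

Fixpoint feval n (phi : lformula R n) : ('I_n -> M) -> R :=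
  match phi with
  | FNorm _ t => fun v => lnorm (teval t v)
  | FConn _ _ f _ psi => fun v => f (\row_i feval (psi i) v)
  | FSup _ r psi => fun v =>
      sup [set feval psi (extend x v) | x in [set x : M | lnorm x <= r%:num]]
  | FInf _ r psi => fun v =>
      inf [set feval psi (extend x v) | x in [set x : M | lnorm x <= r%:num]]
  end.

End Semantics.

Notation lsentence R := (lformula R 0).

Definition seval {R : realType} (M : lstructure R) (s : lsentence R) : R :=
  feval s (fun i : 'I_0 => lzero M).

Definition models {R : realType} (M : lstructure R) (T : set (lsentence R)) :=
  forall s, T s -> seval M s = 0.

Definition theory_of_cstar {R : realType} (T : set (lsentence R)) :=
  forall M : lstructure R, models M T ->
    exists A : cstarAlgType R, lisomorphic M (lstructure_of A).

Definition complete_theory {R : realType} (T : set (lsentence R)) :=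
  (exists M : lstructure R, models M T) /\
  forall M N : lstructure R, models M T -> models N T ->
    forall s, seval M s = seval N s.

(* Main.v *)
(* Both algebras are Skolem hulls of generic sequences of projections. Fix a model M
   and let X be the set of functions from a well-ordered set I to the projections of
   M. For a binary relation Rel on projections that is concurrent (every finite set
   of projections is related to a common one), an ultrafilter W on X contains all
   sets {x | Rel (f x) (x a)}, where f x depends only on the coordinates of x
   below a. The coordinate functions x |-> x a and Skolem functions, applied
   pointwise, generate a set of functions X -> M of size at most 2^aleph_0; modulo W
   it is a model of T by the argument of Los. If countable subsets of I are bounded,
   each of these functions depends on the coordinates below some a only. As almost
   projections are close to projections, each projection p of the hull is thus
   related to the class q_a of the a-th coordinate for all large a.

   In A the relation is "q splits p", and I is omega_1. Since distinct projections
   have distance 1, projections of an ultrapower of A are represented by sequences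
   of projections, and the omega_1 constant sequences q_a split every nonzero
   projection of the ultrapower. In B the relation is "q is nonzero and does not
   split p", and I is omega_2, which is at most 2^aleph_0 if the continuum hypothesis
   fails. Any omega_1 projections of an ultrapower of B then leave some nonzero
   projection unsplit, so the two ultrapowers are not isomorphic. *)

Require Import Defs.
From Stdlib Require Eqdep_dec.
From HB Require Import structures.
From mathcomp Require Import all_boot all_order all_algebra.
From mathcomp Require Import complex.
From mathcomp Require Import all_classical all_reals all_analysis.
From mathcomp Require wochoice.
From mathcomp Require Import ring lra.

Set Implicit Arguments.
Unset Strict Implicit.
Unset Printing Implicit Defensive.

Import Order.TTheory GRing.Theory Num.Theory numFieldNormedType.Exports.

Local Open Scope classical_set_scope.
Local Open Scope card_scope.
Local Open Scope ring_scope.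

(** * Sets of size at most the continuum *)

Definition embeds (A B : Type) := exists f : A -> B, injective f.

Local Notation small T := (embeds T (set nat)).

Lemma embeds_trans (A B C : Type) : embeds A B -> embeds B C -> embeds A C.
Proof. by move=> [f fI] [g gI]; exists (g \o f); exact: inj_comp. Qed.

Lemma embedsW (A B C : Type) (f : A -> B) :
  injective f -> embeds B C -> embeds A C.
Proof. by move=> fI; apply: embeds_trans; exists f. Qed.

Lemma small_count (T : countType) : small T.
Proof.
exists (fun x => [set pickle x]) => x y /seteqP[/(_ (pickle x))/= h _].
by apply: (pcan_inj pickleK); apply: h.
Qed.

(** A sequence of sets of naturals is coded by a single set of coded pairs, whose section at i is
    the i-th set. This is the cardinal identity behind all the size bounds that follow. *)
Lemma small_seq (T : Type) : small T -> small (nat -> T).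
Proof.
move=> [f fI].
exists (fun u => [set n | exists i j, n = pickle (i, j) /\ f (u i) j]) => u v uv.
apply/funext => i; apply/fI/seteqP; split => j fj.
- have : [set n | exists i j, n = pickle (i, j) /\ f (u i) j] (pickle (i, j)).
    by exists i, j.
  by rewrite uv => -[i' [j' [/(pcan_inj pickleK)[-> ->]]]].
- have : [set n | exists i j, n = pickle (i, j) /\ f (v i) j] (pickle (i, j)).
    by exists i, j.
  by rewrite -uv => -[i' [j' [/(pcan_inj pickleK)[-> ->]]]].
Qed.

Lemma small_prod (A B : Type) : small A -> small B -> small (A * B).
Proof.
move=> [f fI] [g gI].
apply: (embedsW (f := fun p n => if n is 0%N then f p.1 else g p.2)).
  move=> [a b] [c d] /= h.
  by rewrite (fI _ _ (congr1 (@^~ 0%N) h)) (gI _ _ (congr1 (@^~ 1%N) h)).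
by apply: small_seq; exists id.
Qed.

Lemma small_option (A : Type) : small A -> small (option A).
Proof.
move=> [f fI].
apply: (embedsW (f := fun o => (isSome o, oapp f set0 o))).
  by move=> [x|] [y|] //= [] /fI ->.
by apply: small_prod; [exact: small_count|exists id].
Qed.

Lemma small_sigT (C : countType) (T : C -> Type) :
  (forall c, small (T c)) -> small {c : C & T c}.
Proof.
move=> h; pose f c := sval (cid (h c)).
have fI c : injective (f c) by rewrite /f; case: cid.
apply: (embedsW (f := fun p => (tag p, f _ (tagged p)))).
  move=> [c x] [d y] /= [cd]; case: d / cd y => y xy.
  by rewrite (fI _ _ _ xy).
by apply: small_prod; [exact: small_count|exists id].
Qed.

Lemma small_sum (A B : Type) : small A -> small B -> small (A + B).
Proof.
move=> sA sB.
apply: (embedsW (B := {b : bool & if b then A else B})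
  (f := fun s => match s with
    | inl a => existT (fun b : bool => if b then A else B) true a
    | inr b => existT (fun b : bool => if b then A else B) false b
    end)); last by apply: small_sigT => -[].
have inj2 := Eqdep_dec.inj_pair2_eq_dec bool (@eq_comparable bool).
by move=> [x|x] [y|y] // h; have -> := inj2 _ _ _ _ h.
Qed.

Lemma small_fun (C : countType) (T : Type) : small T -> small (C -> T).
Proof.
move=> sT; apply: (embedsW (f := fun u n => omap u (unpickle n : option C))).
  move=> u v uv; apply/funext => c.
  by have := congr1 (@^~ (pickle c)) uv; rewrite pickleK /= => -[].
exact/small_seq/small_option.
Qed.

(** Dedekind cuts: a real is determined by the rationals below it. *)
Lemma small_real (R : realType) : small R.
Proof.
apply: (embedsW (f := fun (x : R) (q : rat) => `[< ratr q < x >])); last first.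
  exact/small_fun/small_count.
move=> x y xy; apply/eqP/negPn/negP; rewrite neq_lt => /orP[] /rat_in_itvoo[q];
  rewrite in_itv/= => /andP[q1 q2]; have := congr1 (@^~ q) xy => /=.
- by move/asboolP: q2 => -> /asboolP/lt_trans/(_ q1); rewrite ltxx.
- by move/asboolP: q2 => -> /esym/asboolP/lt_trans/(_ q1); rewrite ltxx.
Qed.

Lemma small_complex (R : realType) : small R[i].
Proof.
apply: (embedsW (f := fun z : R[i] => (complex.Re z, complex.Im z))).
  by move=> [a b] [c d] /= [-> ->].
by apply: small_prod; exact: small_real.
Qed.

Lemma small_posnum (R : realType) : small {posnum R}.
Proof. exact: (embedsW (f := fun e => e%:num) (@val_inj _ _ _) (small_real R)). Qed.

(** Continuous functions that agree at all rational points are equal. A rational point is given by a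
    list of rationals, read with default 0, so the index set is countable. *)
Lemma small_continuous (R : realType) (k : nat) :
  small {f : 'rV[R]_k -> R | continuous f}.
Proof.
apply: (embedsW (f := fun (f : {f : 'rV[R]_k -> R | continuous f}) (s : seq rat) =>
    sval f (\row_i ratr s`_i))); last exact/small_fun/small_real.
move=> [f cf] [g cg] /= fg; apply: eq_exist => /=; apply/funext => v.
apply/eqP/negPn/negP => fgv.
have h0 : 0 < `|f v - g v| by rewrite normr_gt0 subr_eq0.
have : f x - g x @[x --> v] --> f v - g v by exact: (cvgB (cf v) (cg v)).
move/cvgrPdist_lt => /(_ _ h0)/nbhs_ballP[e /= e0 he].
have q (i : 'I_k) : {q : rat | ball (v ord0 i) e (ratr q : R)}.
  apply: cid; have : v ord0 i - e < v ord0 i + e.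
    by rewrite ltrBlDr -addrA ltrDl addr_gt0.
  case/rat_in_itvoo => q; rewrite in_itv/= => vq; exists q.
  by rewrite /ball/= ltr_distlC.
pose s := [seq sval (q i) | i <- enum 'I_k].
have /he : ball v e (\row_i (ratr s`_i : R)).
  split=> // i j; rewrite ord1 mxE (nth_map j) ?size_enum_ord//.
  by rewrite nth_ord_enum; case: (q j).
by rewrite (congr1 (@^~ s) fg) subrr subr0 ltxx.
Qed.

(** * Coding terms and formulas by countably branching trees *)

Inductive tree (L : Type) := Leaf | Node of L & (nat -> tree L).
Arguments Leaf {L}.

(* A tree is determined by the labels found along finite paths from the root. *)
Fixpoint tree_label (L : Type) (t : tree L) (p : seq nat) : option L :=
  match t, p with
  | Leaf, _ => None
  | Node l _, [::] => Some l
  | Node _ k, n :: p => tree_label (k n) p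
  end.

Lemma tree_label_inj (L : Type) : injective (@tree_label L).
Proof.
elim=> [|l k IH] [|l' k'] // h; first by have := congr1 (@^~ [::]) h.
- by have := congr1 (@^~ [::]) h.
- have [<-] := congr1 (@^~ [::]) h; congr Node; apply/funext => n.
  by apply: IH; apply/funext => p; have := congr1 (@^~ (n :: p)) h.
Qed.

Lemma small_tree (L : Type) : small L -> small (tree L).
Proof.
by move=> sL; exact: embedsW (@tree_label_inj L) (small_fun _ (small_option sL)).
Qed.

(** A label holds the number of the constructor, the index of a variable and a scalar; entries that
    do not apply are 0. *)
Fixpoint term_code (R : realType) n (t : lterm R n) : tree (nat * nat * R[i]) :=
  let kids (a b : tree (nat * nat * R[i])) :=
    fun m : nat => if m is 0%N then a else b in
  match t with
  | TVar i => Node (0%N, nat_of_ord i, 0) (fun=> Leaf)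
  | TZero => Node (1%N, 0%N, 0) (fun=> Leaf)
  | TOne => Node (2%N, 0%N, 0) (fun=> Leaf)
  | TAdd s t => Node (3%N, 0%N, 0) (kids (term_code s) (term_code t))
  | TScale a t => Node (4%N, 0%N, a) (fun=> term_code t)
  | TMul s t => Node (5%N, 0%N, 0) (kids (term_code s) (term_code t))
  | TStar t => Node (6%N, 0%N, 0) (fun=> term_code t)
  end.

Lemma term_code_inj (R : realType) n : injective (@term_code R n).
Proof.
elim=> [i||| s IHs t IHt|a t IHt|s IHs t IHt|t IHt]
  [i'||| s' t'|a' t'|s' t'|t'] //= [].
- by move/val_inj ->.
- by move=> h; rewrite (IHs _ (congr1 (@^~ 0%N) h)) (IHt _ (congr1 (@^~ 1%N) h)).
- by move=> <- h; rewrite (IHt _ (congr1 (@^~ 0%N) h)).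
- by move=> h; rewrite (IHs _ (congr1 (@^~ 0%N) h)) (IHt _ (congr1 (@^~ 1%N) h)).
- by move=> h; rewrite (IHt _ (congr1 (@^~ 0%N) h)).
Qed.

Lemma small_term (R : realType) n : small (lterm R n).
Proof.
apply: embedsW (@term_code_inj R n) (small_tree _).
by apply: small_prod; [exact: small_count|exact: small_complex].
Qed.

Section FormulaCode.
Variable R : realType.

Let label : Type := {n & lterm R n} +
  (nat * {k & {f : 'rV[R]_k -> R | continuous f}}) + (bool * nat * {posnum R}).

(** The arguments of a connective are the children numbered below k, and [Leaf] fills the other
    places. Arities are stored in the labels because the type of a formula depends on them. *)
Fixpoint formula_code n (phi : lformula R n) : tree label :=
  match phi with
  | FNorm n t => Node (inl (inl (existT _ n t))) (fun=> Leaf)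
  | FConn n k f cf psi =>
    Node (inl (inr (n, existT _ k (exist _ f cf))))
      (fun i => oapp (fun i => formula_code (psi i)) Leaf (insub i))
  | FSup n r psi => Node (inr (true, n, r)) (fun=> formula_code psi)
  | FInf n r psi => Node (inr (false, n, r)) (fun=> formula_code psi)
  end.

(** The arities n and m are kept independent and are recovered from the labels. Since equality on
    [nat] is decidable, an equality of dependent pairs then yields one of formulas. *)
Lemma formula_code_inj n (phi : lformula R n) m (psi : lformula R m) :
  formula_code phi = formula_code psi ->
  existT (lformula R) n phi = existT (lformula R) m psi.
Proof.
have inj2 := Eqdep_dec.inj_pair2_eq_dec nat (@eq_comparable nat).
elim: phi m psi => {n} [n t|n k f cf phi IH|n r phi IH|n r phi IH] m
  [m' t'|m' k' f' cf' phi'|m' r' phi'|m' r' phi'] //=.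
- by case=> nm; case: _ / nm t' => t' h; have -> := inj2 _ _ _ _ h.
- case=> nm; case: _ / nm phi' => phi' kk'.
  case: _ / kk' f' cf' phi' => f' cf' phi' h0 h; have [ff'] := inj2 _ _ _ _ h0.
  case: _ / ff' cf' {h0} => cf'; rewrite (Prop_irrelevance cf' cf).
  suff -> : phi = phi' by [].
  apply/funext => i; apply: inj2; apply: IH.
  by have := congr1 (@^~ (nat_of_ord i)) h; rewrite /= valK.
- case=> nm; case: _ / nm phi' => phi' <- h.
  by have -> := inj2 _ _ _ _ (IH _ _ (congr1 (@^~ 0%N) h)).
- case=> nm; case: _ / nm phi' => phi' <- h.
  by have -> := inj2 _ _ _ _ (IH _ _ (congr1 (@^~ 0%N) h)).
Qed.

Lemma small_formula : small {n & lformula R n}.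
Proof.
apply: (embedsW (f := fun p => formula_code (tagged p))).
  by move=> [n phi] [m psi] /= /formula_code_inj.
apply/small_tree/small_sum; first apply/small_sum.
- by apply: small_sigT => n; exact: small_term.
- apply: small_prod; first exact: small_count.
  by apply: small_sigT => k; exact: small_continuous.
- by apply: small_prod; [exact: small_count|exact: small_posnum].
Qed.

End FormulaCode.

(** * Two uncountable cofinalities *)

(** Well-founded recursion with a choice at each stage. The values chosen below a are extended to a
    total function by the default b0; as P a looks only below a, the final f may replace this
    extension. *)
Lemma wf_choice (A B : Type) (lt : A -> A -> Prop) (b0 : B)
    (P : A -> (A -> B) -> B -> Prop) :
  well_founded lt ->
  (forall a g g' y, (forall b, lt b a -> g b = g' b) -> P a g y -> P a g' y) ->
  (forall a g, exists y, P a g y) ->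
  exists f, forall a, P a f (f a).
Proof.
move=> wf Pext Pex.
pose ext a (r : forall b, lt b a -> B) b :=
  if pselect (lt b a) is left h then r b h else b0.
pose F a (r : forall b, lt b a -> B) := sval (cid (Pex a (ext a r))).
pose f := Fix wf (fun=> B) F.
have fE a : f a = F a (fun b _ => f b).
  rewrite {1}/f Fix_eq// => x r r' rr'; congr F.
  by apply: functional_extensionality_dep => b; apply: functional_extensionality_dep.
exists f => a; rewrite fE /F; case: cid => y /=; apply: Pext => b ba.
by rewrite /ext; case: pselect.
Qed.

Lemma nat_avoid_countable (C : Type) (S : set C) :
  ~ embeds C nat -> countable S ->
  exists f : nat -> C, injective f /\ forall n, ~ S (f n).
Proof.
move=> nC cS.
have /infiniteP/card_leP[f] : infinite_set (~` S).
  move=> /finite_set_countable cSC; apply: nC.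
  have /countable_injP[f fI] : countable [set: C].
    rewrite -(setUv S) -bigcup2inE; apply: bigcup_countable => //.
    by case=> [|[|n]].
  by exists f => x y; apply: fI; rewrite inE.
exists (fun n => set_val (f (to_setT n))); split=> [m n|n].
  move=> /val_inj/inj h; have /(congr1 set_val) : to_setT m = to_setT n.
    by apply: h; rewrite inE.
  by [].
by have := set_valP (f (to_setT n)).
Qed.

(* The elements of Y with at most |C| predecessors: for C = nat this is the first
   uncountable ordinal, and for C of size aleph_1 it is the next cardinal. *)
Definition short_seg (Y : Type) (lt : Y -> Y -> Prop) (C : Type) :=
  {a : Y | embeds {b | lt b a} C}.

Definition short_lt (Y : Type) (lt : Y -> Y -> Prop) (C : Type)
  (a b : short_seg lt C) := lt (sval a) (sval b).

Section ShortSegments.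
Variables (Y : Type) (lt : Y -> Y -> Prop).
Hypothesis lt_wf : well_founded lt.
Hypothesis lt_trans : forall a b c, lt a b -> lt b c -> lt a c.
Hypothesis lt_total : forall a b, [\/ lt a b, a = b | lt b a].

(** By induction every element is short: if all predecessors of a are short, they form a part of
    [short_seg lt C], which embeds in C. Hence Y consists of short elements only. *)
Lemma embeds_short_seg C : embeds (short_seg lt C) C -> embeds Y C.
Proof.
move=> [f fI].
have h a : embeds {b | lt b a} C.
  elim/(well_founded_ind lt_wf) : a => a IH.
  exists (fun b => f (exist _ (sval b) (IH _ (svalP b)))) => -[b ba] [c ca] /fI [].
  by move=> /= bc; apply: eq_exist.
by exists (fun a => f (exist _ a (h a))) => a b /fI[].
Qed.

Lemma short_lt_wf C : well_founded (@short_lt Y lt C).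
Proof.
move=> [a aC]; elim/(well_founded_ind lt_wf) : a aC => a IH aC.
by constructor => -[b bC] ba; exact: IH.
Qed.

Lemma short_lt_trans C (a b c : short_seg lt C) :
  short_lt a b -> short_lt b c -> short_lt a c.
Proof. exact: lt_trans. Qed.

Lemma short_lt_total C (a b : short_seg lt C) :
  [\/ short_lt a b, a = b | short_lt b a].
Proof.
have [h|h|h] := lt_total (sval a) (sval b); first exact: Or31.
- by apply: Or32; apply: eq_sig_hprop => // x; exact: Prop_irrelevance.
- exact: Or33.
Qed.

(** An injection of the predecessors of a, made total: elsewhere it takes the value at a fixed
    predecessor, or c0 if there is none. *)
Lemma short_seg_pred C (c0 : C) (a : short_seg lt C) :
  exists g : short_seg lt C -> C, forall b c,
    short_lt b a -> short_lt c a -> g b = g c -> b = c.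
Proof.
have [f fI] := svalP a.
have [b0|n] := pselect (exists b, short_lt b a); last first.
  by exists (fun=> c0) => b c ba; case: n; exists b.
case: (cid b0) => b1 b1a.
exists (fun b => if pselect (short_lt b a) is left h then f (exist _ (sval b) h)
                else f (exist _ (sval b1) b1a)) => b c ba ca.
case: pselect => // h; case: pselect => // h' /fI[bc].
by apply: eq_sig_hprop => // x; exact: Prop_irrelevance.
Qed.

(** Regularity of a successor cardinal. If f were unbounded, each a would lie at or below some f d;
    the index d and the place of a below f d, with [None] for a = f d, determine a. *)
Lemma short_seg_bounded (C D : Type) (c0 : C) (f : D -> short_seg lt C) :
  ~ embeds (short_seg lt C) (D * option C) ->
  exists a, forall d, short_lt (f d) a.
Proof.
apply: contra_notP => /forallNP nb.
have {}nb a : exists d, ~ short_lt (f d) a by exact/existsNP.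
pose d a := sval (cid (nb a)).
have dP a : short_lt a (f (d a)) \/ a = f (d a).
  rewrite /d; case: cid => x /= nx; case: (short_lt_total a (f x)); by [left|right|].
pose g a := sval (cid (short_seg_pred c0 a)).
have gP a b c : short_lt b a -> short_lt c a -> g a b = g a c -> b = c.
  by rewrite /g; case: cid => h /= hP; exact: hP.
exists (fun a => (d a, if `[< a = f (d a) >] then None else Some (g (f (d a)) a))).
move=> a b /= [dab].
case: asboolP => [a1|na]; case: asboolP => [b1|nb'] //.
  by rewrite a1 b1 dab.
move=> [gab]; apply: (gP (f (d a))).
- by case: (dP a).
- by rewrite dab; case: (dP b).
- by rewrite {2}dab.
Qed.

Local Notation I1 := (short_seg lt nat).

(** By recursion on a, pick an injective sequence in C that avoids the sequences picked before.
    These fill only a countable set, since a has countably many predecessors. *)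
Lemma omega1_mul_nat (C : Type) : ~ embeds C nat -> embeds (I1 * nat) C.
Proof.
move=> nC.
have [c0 _] := nat_avoid_countable nC (@countable0 C).
pose P a (g : I1 -> nat -> C) (y : nat -> C) := injective y /\
  forall b m n, short_lt b a -> y m <> g b n.
have [f fP] : exists f, forall a, P a f (f a).
  apply: (wf_choice c0 (@short_lt_wf nat)) => [a g g' y gg' [yI yg]|].
    by split=> // b m n ba; rewrite -gg'//; exact: yg.
  move=> a g.
  have [] := @nat_avoid_countable C
    (\bigcup_(b in [set b | short_lt b a]) range (g b)) nC.
    apply: bigcup_countable; last by move=> b _; exact: card_image_le.
    have [h hI] := short_seg_pred 0%N a; apply/countable_injP; exists h => b c.
    by rewrite !inE; exact: hI.
  move=> y [yI yS]; exists y; split=> // b m n ba ymn; apply: (yS m).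
  by exists b => //; exists n.
exists (fun p => f p.1 p.2) => -[a m] [b n] /= ab.
have [ltab|eab|ltba] := short_lt_total a b.
- by have [_ /(_ a n m ltab)] := fP b; rewrite ab.
- by move: ab; rewrite eab => /(proj1 (fP b)) ->.
- by have [_ /(_ b m n ltba)] := fP a.
Qed.

(** A pair is coded by its larger entry, the place of the smaller one below it and a bit for the
    order, with [None] on the diagonal. This reduces the square to the product with [nat]. *)
Lemma omega1_mul : ~ embeds I1 nat -> embeds (I1 * I1) I1.
Proof.
move=> nI; apply: embeds_trans (omega1_mul_nat nI).
pose g a := sval (cid (@short_seg_pred nat 0%N a)).
have gP a b c : short_lt b a -> short_lt c a -> g a b = g a c -> b = c.
  by rewrite /g; case: cid => h /= hP; exact: hP.
pose F (p : I1 * I1) : I1 * option (bool * nat) :=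
  if pselect (short_lt p.1 p.2) then (p.2, Some (true, g p.2 p.1)) else
  if pselect (short_lt p.2 p.1) then (p.1, Some (false, g p.1 p.2)) else (p.1, None).
apply: (@embedsW _ (I1 * option (bool * nat)) _ F); last first.
  exists (fun p => (p.1, pickle p.2)) => -[a m] [b n] /= [->].
  by move=> /(pcan_inj pickleK) ->.
have eqI (a b : I1) : ~ short_lt a b -> ~ short_lt b a -> a = b.
  by move=> ? ?; case: (short_lt_total a b).
move=> [a b] [c d]; rewrite /F /=.
case: (pselect (short_lt a b)) => [ab|nab] /=;
  case: (pselect (short_lt c d)) => [cd|ncd] /=.
- by case=> bd; rewrite -bd in cd *; move/(gP _ _ _ ab cd) => ->.
- by case: pselect.
- by case: pselect.
- case: (pselect (short_lt b a)) => [ba|nba] /=;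
  case: (pselect (short_lt d c)) => [dc|ndc] //=.
  + by case=> ac; rewrite -ac in dc *; move/(gP _ _ _ ba dc) => ->.
  + by case=> ac; rewrite -(eqI _ _ nab nba) -(eqI _ _ ncd ndc) ac.
Qed.

End ShortSegments.

(** The well-ordering principle provides unique least elements of nonempty sets. Applied to sets of
    two or three elements, it gives totality, antisymmetry and transitivity. *)
Lemma wf_order_set_nat : exists lt : set nat -> set nat -> Prop,
  [/\ well_founded lt, forall a b c, lt a b -> lt b c -> lt a c &
      forall a b, [\/ lt a b, a = b | lt b a]].
Proof.
have [le le_wo] := wochoice.well_ordering_principle (set nat).
have minP (A : set (set nat)) a : A a ->
    exists z, A z /\ forall x, A x -> le z x.
  move=> Aa; have [|z [[zA zmin] _]] := le_wo (mem A).
    by exists a; rewrite inE.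
  by exists z; split=> [|x Ax]; [rewrite inE in zA|apply: zmin; rewrite inE].
have le_total a b : le a b || le b a.
  have [//|z [[->|->] h]] := minP [set x | x = a \/ x = b] a; first by left.
    by rewrite h//; right.
  by rewrite (h a) ?orbT//; left.
have le_anti a b : le a b -> le b a -> a = b.
  move=> ab ba; have [|z [_ zU]] := le_wo (mem [set x | x = a \/ x = b]).
    by exists a; rewrite inE; left.
  have aa : le a a by have := le_total a a; rewrite orbb.
  have bb : le b b by have := le_total b b; rewrite orbb.
  rewrite -(zU a) ?(zU b)//; split.
  - by rewrite inE; right.
  - by move=> x; rewrite inE => -[] ->.
  - by rewrite inE; left.
  - by move=> x; rewrite inE => -[] ->.
have le_trans a b c : le a b -> le b c -> le a c.
  move=> ab bc.
  have [|z [zabc zmin]] := minP [set x | [\/ x = a, x = b | x = c]] a.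
    exact: Or31.
  have za : le z a by apply: zmin; exact: Or31.
  have zb : le z b by apply: zmin; exact: Or32.
  have zc : le z c by apply: zmin; exact: Or33.
  case: zabc => ze; rewrite ze in za zb zc => //.
  - by rewrite (le_anti _ _ ab za).
  - by rewrite -(le_anti _ _ bc zb) in za *.
exists (fun a b => le a b /\ a <> b); split.
- move=> a; apply: contrapT => na.
  have [z [nz zmin]] := minP [set x | ~ Acc (fun a b => le a b /\ a <> b) x] a na.
  apply: nz; constructor => y [yz ynz]; apply: contrapT => /zmin zy.
  by apply: ynz; exact: le_anti.
- move=> a b c [ab nab] [bc nbc]; split; first exact: le_trans bc.
  by move=> ac; apply: nab; apply: le_anti => //; rewrite ac.
- move=> a b; have [->|nab] := pselect (a = b); first exact: Or32.
  have /orP[h|h] := le_total a b; [exact: Or31|].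
  by apply: Or33; split=> // ba; exact: nab.
Qed.

Lemma set_nat_uncountable : ~ embeds (set nat) nat.
Proof.
move=> [f fI]; pose D := [set n | exists2 S, f S = n & ~ S n].
have [Df|nDf] := pselect (D (f D)); last by apply: (nDf); exists D.
by case: (Df) => S /fI ->; apply.
Qed.

(** The index sets are omega_1 and omega_2, cut out of a well-order of [set nat]. The last clause
    says that families of aleph_1 elements of omega_2 are bounded; the index set I1 * nat suits
    sequences representing aleph_1 elements of an ultrapower. *)
Lemma two_cofinalities : ~ continuum_hypothesis ->
  exists (I1 I2 : Type) (lt1 : I1 -> I1 -> Prop) (lt2 : I2 -> I2 -> Prop),
  [/\ inhabited I1 /\ inhabited I2, small I1 /\ small I2,
    [/\ well_founded lt1, forall a b c, lt1 a b -> lt1 b c -> lt1 a c &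
        forall f : nat -> I1, exists a, forall n, lt1 (f n) a] &
    [/\ well_founded lt2, forall a b c, lt2 a b -> lt2 b c -> lt2 a c &
        forall f : I1 * nat -> I2, exists a, forall x, lt2 (f x) a]].
Proof.
move=> nCH; have [lt [lt_wf lt_trans lt_total]] := wf_order_set_nat.
pose I1 := short_seg lt nat; pose I2 := short_seg lt I1.
have small_short C : small (short_seg lt C).
  by exists sval => a b ab; apply: eq_sig_hprop => // x; exact: Prop_irrelevance.
have nI1 : ~ embeds I1 nat.
  by move=> /(embeds_short_seg lt_wf); exact: set_nat_uncountable.
have I1nat C : ~ embeds C nat -> embeds (I1 * nat) C.
  exact: omega1_mul_nat.
have nI2 : ~ embeds I2 I1.
  (* If I2 embedded in I1, so would [set nat]. As I1 embeds in every uncountable X, all such X would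
     have the size of the continuum. *)
  move=> /(embeds_short_seg lt_wf) YI; apply: nCH => X.
  have [|nX] := pselect (countable X); first by left.
  right; rewrite card_eq_le card_leT/= .
  have /(embeds_trans YI)[f fI] : embeds I1 {x | X x}.
    apply: embeds_trans (I1nat _ _).
      by exists (fun a => (a, 0%N)) => a b [].
    move=> [f fI]; apply: nX; apply/countable_injP.
    have [h hE] : exists h : set nat -> nat, forall x (Xx : X x), h x = f (exist _ x Xx).
      exists (fun x => if pselect (X x) is left Xx then f (exist _ x Xx) else 0%N).
      move=> x Xx; case: pselect => // Xx'; congr (f (exist _ _ _)).
      exact: Prop_irrelevance.
    exists h => x y /set_mem Xx /set_mem Xy; rewrite (hE _ Xx) (hE _ Xy).
    by move=> /fI[].
  suff : [set: set nat] #<= X by [].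
  apply/pcard_leP/injfunPex => /=; exists (fun s => sval (f s)).
    by move=> s _; exact: svalP.
  move=> s t _ _ h; apply: fI; apply: eq_sig_hprop => // x; exact: Prop_irrelevance.
have [u0 _] := nat_avoid_countable nI1 (@countable0 I1); pose i0 := u0 0%N.
exists I1, I2, (@short_lt _ lt nat), (@short_lt _ lt I1); split.
- split; first by constructor.
  apply: contrapT => nI2'; apply: nI2.
  by exists (fun a => match nI2' (inhabits a) with end) => a; case: nI2'.
- by split; exact: small_short.
- split; [exact: short_lt_wf|exact: short_lt_trans|move=> f].
  apply: (short_seg_bounded lt_total 0%N) => // /embeds_trans h; apply: nI1; apply: h.
  by exists pickle; exact: (pcan_inj pickleK).
- split; [exact: short_lt_wf|exact: short_lt_trans|move=> f].
  apply: (short_seg_bounded lt_total i0) => // /embeds_trans h; apply: nI2; apply: h.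
  (* An unbounded family would embed I2 in (I1 * nat) * option I1, where both factors embed in
     I1. *)
  apply: (@embeds_trans _ (I1 * I1)); last exact: omega1_mul.
  have [u uI] := I1nat _ nI1.
  have [w wI] : embeds (option I1) I1.
    apply: (embedsW (f := fun o => if o is Some a then (a, 1%N) else (i0, 0%N))).
      by move=> [a|] [b|] //= [->].
    exact: I1nat.
  by exists (fun p => (u p.1, w p.2)) => -[a b] [c d] /= [/uI-> /wI->].
Qed.

(** * Projections in C*-algebras *)

Section PseudoLimit.
Variables (R : realType) (T : Type) (d : T -> T -> R).
Hypothesis d0 : forall x, d x x = 0.
Hypothesis d_sym : forall x y, d x y = d y x.
Hypothesis d_triangle : forall x y z, d x z <= d x y + d y z.
Hypothesis d_complete : cauchy_complete d.

(** Subtracting the tail 2C / 2^n turns the geometric sum into an exact telescoping bound, which the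
    induction on n preserves. *)
Lemma geometric_dist (C : R) (u : nat -> T) m n : (m <= n)%N ->
  (forall i, (i < n)%N -> d (u i) (u i.+1) <= C / 2 ^+ i) ->
  d (u m) (u n) <= 2 * C / 2 ^+ m - 2 * C / 2 ^+ n.
Proof.
elim: n => [|n IH].
  by rewrite leqn0 => /eqP-> _; rewrite d0 subrr.
rewrite leq_eqVlt => /predU1P[-> _|]; first by rewrite d0 subrr.
rewrite ltnS => mn du; apply: (le_trans (d_triangle _ (u n) _)).
have -> : 2 * C / 2 ^+ m - 2 * C / 2 ^+ n.+1 =
    2 * C / 2 ^+ m - 2 * C / 2 ^+ n + C / 2 ^+ n.
  have p2 k : 2 ^+ k != 0 :> R by rewrite expf_neq0.
  by rewrite exprS; field; rewrite !p2.
by rewrite lerD ?du// IH// => i /ltnW; exact: du.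
Qed.

(* The limit of u if all the estimates hold, and otherwise the last term before
   the first failure; hence a bound valid for finite initial segments. *)
Lemma pseudo_limit (C : R) (u : nat -> T) : 0 <= C ->
  exists l, forall n, (forall i, (i < n)%N -> d (u i) (u i.+1) <= C / 2 ^+ i) ->
    d l (u n) <= 2 * C / 2 ^+ n.
Proof.
move=> C0.
have le_geom m n : (m <= n)%N ->
    (forall i, (i < n)%N -> d (u i) (u i.+1) <= C / 2 ^+ i) ->
    d (u m) (u n) <= 2 * C / 2 ^+ m.
  move=> mn h; apply: (le_trans (geometric_dist mn h)).
  by rewrite gerBl divr_ge0 ?mulr_ge0// exprn_ge0.
have [du|/existsNP[k0 k0P]] := pselect (forall i, d (u i) (u i.+1) <= C / 2 ^+ i).
  have geom0 : 2 * C / 2 ^+ n @[n --> \oo] --> (0 : R).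
    under eq_fun do rewrite -exprVn.
    by apply: (@cvg_geometric R (2 * C) 2^-1); rewrite ger0_norm// invf_lt1// ltr1n.
  have [|l ul] := d_complete (u := u).
    move=> e e0; have /cvgrPdist_lt/(_ e e0) [N _ hN] := geom0.
    exists N => m n Nm Nn.
    wlog mn : m n Nm Nn / (m <= n)%N.
      by move=> h; case/orP: (leq_total m n) => ?; [|rewrite d_sym]; exact: h.
    apply: (le_lt_trans (le_geom _ _ mn (fun i _ => du i))).
    have := hN m Nm; rewrite /= sub0r normrN ger0_norm//.
    by rewrite divr_ge0 ?mulr_ge0// exprn_ge0.
  exists l => n _; apply/ler_addgt0Pr => e e0.
  have /cvgrPdist_lt/(_ e e0)[N _ hN] := ul.
  have := hN (maxn N n) (leq_maxl _ _); rewrite /= sub0r normrN => /ltr_normlW ue.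
  apply: (le_trans (d_triangle _ (u (maxn N n)) _)); rewrite addrC lerD//.
    by rewrite d_sym; apply: le_geom; [exact: leq_maxr|].
  by rewrite d_sym ltW.
have kP : exists k, ~~ (d (u k) (u k.+1) <= C / 2 ^+ k) by exists k0; exact/negP.
case: (ex_minnP kP) => k nk kmin; exists (u k) => n du.
have nk' : (n <= k)%N by rewrite leqNgt; apply/negP => /du; exact/negP.
rewrite d_sym; apply: le_geom => // i; rewrite ltnNge => /negP ki.
by apply: contrapT => /negP /kmin.
Qed.

End PseudoLimit.

Lemma star0 (C : numClosedFieldType) (B : starAlgType C) : star (0 : B) = 0.
Proof. by have := starB (0 : B) 0; rewrite !subrr. Qed.

Section CStarProjections.
Variables (R : realType) (A : cstarAlgType R).
Implicit Types a b p q x : A.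

Lemma cnorm_mulrn x n : cnorm (x *+ n) <= cnorm x *+ n.
Proof.
elim: n => [|n IH]; first by rewrite !mulr0n cnorm0.
by rewrite !mulrS (le_trans (cnormD _ _))// lerD2l.
Qed.

Lemma cnorm_sqr_sa x : star x = x -> cnorm (x * x) = cnorm x ^+ 2.
Proof. by move=> sx; rewrite -cstar_identity sx. Qed.

Lemma star1 : star (1 : A) = 1.
Proof. by rewrite -[LHS]mulr1 -{2}[1]starK -starM mulr1 starK. Qed.

(* Newton's method for x^2 = x replaces a by 3a^2 - 2a^3, and squares the error
   a^2 - a up to a bounded factor. *)
Lemma newton_step a (e : R) : star a = a -> cnorm (a * a - a) <= e -> e <= 1 / 8 ->
  exists b, [/\ star b = b, cnorm (b * b - b) <= e / 2 & cnorm (a - b) <= 2 * e].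
Proof.
move=> sa ae e8.
have e0 : 0 <= e := le_trans (cnorm_ge0 _) ae.
set x := a * a - a in ae *; pose y := 1 - a *+ 2; pose b := a + x * y.
(* Identities between polynomials in a are checked by [ring] in the commutative ring of polynomials
   and transported by evaluation at a. *)
have ev (p q : {poly R[i]}) : p = q -> horner_alg a p = horner_alg a q by move->.
have yy : y * y = 1 + x *+ 4.
  have /ev : (1 - 'X *+ 2) * (1 - 'X *+ 2) = 1 + ('X * 'X - 'X) *+ 4 :> {poly R[i]}.
    by ring.
  by rewrite !(rmorphM, rmorphB, rmorphD, rmorphMn, rmorph1) /= !horner_algX.
have bb : b * b - b = x * x * (x *+ 4 - 3%:R).
  have /ev : ('X + ('X * 'X - 'X) * (1 - 'X *+ 2)) * ('X + ('X * 'X - 'X) * (1 - 'X *+ 2))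
      - ('X + ('X * 'X - 'X) * (1 - 'X *+ 2)) =
      ('X * 'X - 'X) * ('X * 'X - 'X) * (('X * 'X - 'X) *+ 4 - 3%:R) :> {poly R[i]}.
    by ring.
  by rewrite !(rmorphM, rmorphB, rmorphD, rmorphMn, rmorph1) /= !horner_algX.
have xy : x * y = y * x.
  have /ev : ('X * 'X - 'X) * (1 - 'X *+ 2) = (1 - 'X *+ 2) * ('X * 'X - 'X) :> {poly R[i]}.
    by ring.
  by rewrite !(rmorphM, rmorphB, rmorphD, rmorphMn, rmorph1) /= !horner_algX.
have sx : star x = x by rewrite /x starB starM sa.
have sy : star y = y by rewrite /y starB star1 mulr2n starD sa.
have y2 : cnorm y <= 2.
  rewrite -(@ler_pXn2r _ 2)// ?nnegrE ?cnorm_ge0// -cnorm_sqr_sa// yy.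
  apply: (le_trans (cnormD _ _)); rewrite cnorm1.
  have := cnorm_mulrn x 4; lra.
exists b; split.
- by rewrite /b starD starM sx sy sa xy.
- rewrite bb; apply: (le_trans (cnormM _ _)).
  have h1 : cnorm (x * x) <= e * e.
    by apply: (le_trans (cnormM _ _)); rewrite ler_pM ?cnorm_ge0.
  have h2 : cnorm (x *+ 4 - 3%:R) <= 7 / 2.
    apply: (le_trans (cnormB _ _)); have := cnorm_mulrn x 4.
    by have := cnorm_mulrn 1 3; rewrite cnorm1; lra.
  apply: (@le_trans _ _ (e * e * (7 / 2))); last by nra.
  by rewrite ler_pM ?cnorm_ge0.
- rewrite /b opprD addrA subrr sub0r cnormN (le_trans (cnormM _ _))// mulrC.
  by rewrite ler_pM ?cnorm_ge0.
Qed.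

Lemma le0_geometric (x K : R) : (forall n, x <= K / 2 ^+ n) -> x <= 0.
Proof.
move=> h; have : K / 2 ^+ n @[n --> \oo] --> (0 : R).
  under eq_fun do rewrite -exprVn.
  by apply: (@cvg_geometric R K 2^-1); rewrite ger0_norm// invf_lt1// ltr1n.
move=> h0; rewrite -(cvg_lim _ h0)//; apply: limr_ge; first exact: cvgP h0.
exact: nearW.
Qed.

(** Newton steps halve the error bound each time and the n-th step moves by at most 2e / 2^n, so the
    iterates converge to a projection within 4e of a. *)
Lemma near_projection a : star a = a -> cnorm (a * a - a) <= 1 / 8 ->
  exists2 p, is_projection p & cnorm (a - p) <= 4 * cnorm (a * a - a).
Proof.
move=> sa ae; set e := cnorm _ in ae *.
have e0 : 0 <= e := cnorm_ge0 _.
have e2 n : e / 2 ^+ n <= 1 / 8.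
  apply: le_trans ae; rewrite ler_pdivrMr ?exprn_gt0//.
  by rewrite ler_peMr// exprn_ege1// ler1n.
pose good n b := star b = b /\ cnorm (b * b - b) <= e / 2 ^+ n.
(* The premise [good n b] stands under the existential, so that choice gives a total function to
   iterate. *)
have step n b : exists b', good n b -> good n.+1 b' /\ cnorm (b - b') <= 2 * e / 2 ^+ n.
  have [[sb be]|ng] := pselect (good n b); last by exists b.
  have [b' [? h1 h2]] := newton_step sb be (e2 n); exists b' => _.
  by split; [split=> //; rewrite exprSr invfM mulrA|rewrite -mulrA].
pose f n b := sval (cid (step n b)).
pose u := fix u n := if n is n'.+1 then f n' (u n') else a.
have fP n b : good n b -> good n.+1 (f n b) /\ cnorm (b - f n b) <= 2 * e / 2 ^+ n.
  by rewrite /f; case: cid.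
have gu n : good n (u n).
  elim: n => [|n IH]; first by split=> //=; rewrite expr0 divr1.
  by have [] := fP n _ IH.
have [l lP] := @pseudo_limit R A (fun x y => cnorm (x - y))
  (fun x => etrans (congr1 (@cnorm R A) (subrr x)) (@cnorm0 R A))
  cnorm_distC cnorm_distD (@cnorm_complete R A) (2 * e) u (mulr_ge0 (ler0n _ _) e0).
have {}lP n : cnorm (l - u n) <= 4 * e / 2 ^+ n.
  have -> : 4 * e = 2 * (2 * e) by ring.
  by apply: lP => i _; have [_] := fP i _ (gu i).
have eq_geom x K : (forall n, cnorm x <= K / 2 ^+ n) -> x = 0.
  by move=> /le0_geometric x0; apply: cnorm0_eq0; apply/eqP; rewrite eq_le x0 cnorm_ge0.
have sl : star l = l.
  apply/eqP; rewrite -subr_eq0; apply/eqP; apply: (eq_geom _ (8 * e)) => n.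
  apply: (le_trans (cnorm_distD _ (u n) _)); have := lP n.
  rewrite -{2}(gu n).1 -starB cnorm_star (cnorm_distC (u n)).
  have -> : 8 * e / 2 ^+ n = 4 * e / 2 ^+ n + 4 * e / 2 ^+ n by ring.
  by move=> h; rewrite lerD.
have ll : l * l = l.
  apply/eqP; rewrite -subr_eq0; apply/eqP.
  (* The constant adds up the bounds of l(l - u), (l - u)u, u^2 - u and l - u for u = u n, whose
     norm is at most that of l plus 1. *)
  apply: (eq_geom _ ((2 * cnorm l + 1) * (4 * e) + e + 4 * e)) => n.
  have -> : l * l - l = l * (l - u n) + (l - u n) * u n + (u n * u n - u n) - (l - u n).
    by rewrite mulrBr mulrBl !addrA !subrK opprB addrA subrK.
  have un : cnorm (u n) <= cnorm l + 1.
    have -> : u n = l - (l - u n) by rewrite opprB addrC subrK.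
    apply: (le_trans (cnormB _ _)); rewrite lerD2l (le_trans (lP n))//.
    by have := e2 n; lra.
  have k0 : 0 <= 4 * e / 2 ^+ n := le_trans (cnorm_ge0 _) (lP n).
  have n0 := cnorm_ge0 l.
  have -> : ((2 * cnorm l + 1) * (4 * e) + e + 4 * e) / 2 ^+ n =
    cnorm l * (4 * e / 2 ^+ n) + (4 * e / 2 ^+ n) * (cnorm l + 1) + e / 2 ^+ n
    + 4 * e / 2 ^+ n by ring.
  apply: (le_trans (cnormB _ _)); rewrite lerD//.
  apply: (le_trans (cnormD _ _)); rewrite lerD//; last exact: (gu n).2.
  apply: (le_trans (cnormD _ _)).
  by rewrite lerD// (le_trans (cnormM _ _))// ler_pM ?cnorm_ge0.
exists l; first by split.
by have := lP 0%N; rewrite expr0 divr1 cnorm_distC.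
Qed.

Lemma projection0 : is_projection (0 : A).
Proof. by split; rewrite ?star0 ?mulr0. Qed.

Lemma projection1 : is_projection (1 : A).
Proof. by split; rewrite ?star1 ?mulr1. Qed.

Lemma projection_compl p : is_projection p -> is_projection (1 - p).
Proof.
move=> [sp pp]; split; first by rewrite starB star1 sp.
by rewrite mulrBl mul1r mulrBr mulr1 pp subrr subr0.
Qed.

Lemma projection_mul p q : is_projection p -> is_projection q -> p * q = q * p ->
  is_projection (p * q).
Proof.
move=> [sp pp] [sq qq] pq; split; first by rewrite starM sp sq.
by rewrite mulrA -(mulrA p q) -pq mulrA pp -mulrA qq.
Qed.

Lemma projection_norm p : is_projection p -> p <> 0 -> cnorm p = 1.
Proof.
move=> [sp pp] p0; have n0 : cnorm p != 0.
  by apply/eqP => /cnorm0_eq0.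
by apply: (mulfI n0); rewrite mulr1 -expr2 -cnorm_sqr_sa// pp.
Qed.

Lemma projection_norm_le1 p : is_projection p -> cnorm p <= 1.
Proof.
move=> pP; have [->|p0] := pselect (p = 0); first by rewrite cnorm0.
by rewrite projection_norm.
Qed.

Lemma projection_eq0 p : is_projection p -> cnorm p < 1 -> p = 0.
Proof.
by move=> pP p1; apply: contrapT => /(projection_norm pP) h; rewrite h ltxx in p1.
Qed.

(** * Splitting and deciding finitely many commuting projections *)

Hypothesis comm : forall p q : A, is_projection p -> is_projection q -> p * q = q * p.

Lemma projection_meet p q : is_projection p -> is_projection q ->
  is_projection (p * q).
Proof. by move=> pP qP; apply: projection_mul => //; exact: comm. Qed.

(** Since p and q commute, p(1 - q) = p(p - q) is a projection of norm below 1, hence 0, which means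
    p = pq. By symmetry q = qp. *)
Lemma projection_dist p q : is_projection p -> is_projection q ->
  cnorm (p - q) < 1 -> p = q.
Proof.
move=> pP qP pq1.
have le_of p' q' : is_projection p' -> is_projection q' -> cnorm (p' - q') < 1 ->
    p' = p' * q'.
  move=> pP' qP' h; apply/eqP; rewrite -subr_eq0; apply/eqP.
  have {1}-> : p' = p' * 1 by rewrite mulr1.
  rewrite -mulrBr; apply: projection_eq0.
    by apply: projection_meet => //; exact: projection_compl.
  rewrite mulrBr mulr1 -{1}pP'.2 -mulrBr (le_lt_trans (cnormM _ _))//.
  by rewrite (le_lt_trans _ h)// ler_piMl ?cnorm_ge0// projection_norm_le1.
by rewrite (le_of _ _ pP qP pq1) comm// -le_of// cnorm_distC.
Qed.

(* The product of commuting projections is their meet; [splits q p] is vacuous for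
   p = 0. *)
Definition splits q p := p <> 0 -> p * q <> 0 /\ p * q <> p.

(** The roles are exchanged with respect to [splits]: the nonzero r is not split by p, as it lies
    below p or is orthogonal to it. *)
Definition decides r p := r <> 0 /\ (p * r = r \/ p * r = 0).

(** Start with r = 1 and replace r by its meet with p n unless that meet is 0. Decisions made
    earlier persist for smaller r. *)
Lemma exists_decides n (p : nat -> A) : (forall i, is_projection (p i)) ->
  exists2 r, is_projection r & forall i, (i < n)%N -> decides r (p i).
Proof.
move=> pP; suff [r [rP r0 rp]] : exists r, [/\ is_projection r, r <> 0 &
    forall i, (i < n)%N -> p i * r = r \/ p i * r = 0].
  by exists r => // i /rp; split.
elim: n => [|n [r [rP r0 rp]]].
  exists 1; split=> //; first exact: projection1.
  by apply/eqP; rewrite oner_eq0.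
have [z|nz] := pselect (p n * r = 0).
  exists r; split=> // i; rewrite ltnS leq_eqVlt => /predU1P[->|/rp//].
  by right.
exists (p n * r); split=> //; first exact: projection_meet.
move=> i; rewrite ltnS leq_eqVlt => /predU1P[->|/rp].
  by left; rewrite mulrA (pP n).2.
by rewrite mulrA (comm (pP i) (pP n)) -mulrA => -[]->; [left|right; rewrite mulr0].
Qed.

Hypothesis no_minimal : forall p : A, is_projection p -> p <> 0 ->
  exists q : A, [/\ is_projection q, proj_lt 0 q & proj_lt q p].

(** Here t lies below p but above none of the z i. If t lies above z n, pass to a nonzero s strictly
    below z n; then s is below t, so it contains none of the earlier z i either. *)
Lemma small_subprojection n (z : nat -> A) p :
  (forall i, (i < n)%N -> is_projection (z i) /\ z i <> 0) ->
  is_projection p -> p <> 0 ->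
  exists t, [/\ is_projection t, t <> 0, t * p = t &
    forall i, (i < n)%N -> z i * t <> z i].
Proof.
move=> zP pP p0; elim: n zP => [|n IH] zP; first by exists p; split=> //; exact: pP.2.
have [i /ltnW/zP//|t [tP t0 tp zt]] := IH.
have [zn|nzn] := pselect (z n * t = z n); last first.
  by exists t; split=> // i; rewrite ltnS leq_eqVlt => /predU1P[->|/zt].
have [znP zn0] := zP n (leqnn _).
have [s [sP [_ s0] [szn snzn]]] := no_minimal znP zn0; rewrite /proj_le in szn.
have st : s * t = s by rewrite -szn -mulrA zn.
exists s; split=> //; first exact/nesym.
  by rewrite -st -mulrA tp.
move=> i; rewrite ltnS leq_eqVlt => /predU1P[->|/[dup] ni /zt zit].
  by rewrite comm// szn.
move=> zis; apply: zit; rewrite -zis -mulrA st//.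
Qed.

(** Suppose that q splits the earlier p i but not p n. Up to replacing q by 1 - q, p n lies below q;
    then a sufficiently small nonzero t below p n is removed from q. *)
Lemma exists_splits n (p : nat -> A) : (forall i, is_projection (p i)) ->
  exists2 q, is_projection q & forall i, (i < n)%N -> splits q (p i).
Proof.
move=> pP; elim: n => [|n [q qP qp]]; first by exists 0 => //; exact: projection0.
have main : forall q', is_projection q' -> (forall i, (i < n)%N -> splits q' (p i)) ->
    p n <> 0 -> p n * q' = p n ->
    exists2 q, is_projection q & forall i, (i < n.+1)%N -> splits q (p i).
  move=> {q qP qp} q qP qp pn0 pnq.
  (* These must not lie below t: p n, so that p n - t is nonzero, and p i * q, so that p i still
     meets q(1 - t). For p i = 0 the value p n is a filler, since each z i has to be nonzero. *)
  pose z i := if `[< i = n \/ p i = 0 >] then p n else p i * q.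
  have zP i : (i < n.+1)%N -> is_projection (z i) /\ z i <> 0.
    rewrite ltnS leq_eqVlt => h; rewrite /z; case: asboolP => [_|].
      by split.
    move=> /not_orP[iNn pi0]; split; first exact: projection_meet.
    by case/predU1P: h => // ni; case: (qp _ ni pi0).
  have [t [tP t0 tpn zt]] := small_subprojection zP (pP n) pn0.
  have tq : t * q = t by rewrite -tpn -mulrA pnq.
  have tP' := projection_compl tP.
  exists (q * (1 - t)); first exact: projection_meet.
  move=> i; rewrite ltnS leq_eqVlt => /predU1P[->|ni] pi0.
    rewrite mulrA pnq mulrBr mulr1 comm// tpn; split.
      move=> /eqP; rewrite subr_eq0 => /eqP pnt.
      have := zt n (leqnn _); rewrite /z; case: asboolP; last by case; left.
      by rewrite -pnt pnt tP.2 => _; apply.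
    by move=> /eqP; rewrite subr_eq addrC -subr_eq subrr => /eqP/esym.
  have [piq0 piqi] := qp _ ni pi0; rewrite mulrA mulrBr mulr1; split.
    move=> /eqP; rewrite subr_eq0 => /eqP h; have := zt i (ltnW ni).
    rewrite /z; case: asboolP => [[inn|//]|_]; first by rewrite inn ltnn in ni.
    by move=> /nesym; apply.
  move=> h; apply: piqi; rewrite -{1}h mulrBl -!mulrA qP.2 tq.
  by rewrite -[RHS]h mulrA.
have [pn0|pn0] := pselect (p n = 0).
  by exists q => // i; rewrite ltnS leq_eqVlt => /predU1P[-> //|/qp].
have [pnq|pnq] := pselect (p n * q = p n); first exact: (main q).
have [pnq0|pnq0] := pselect (p n * q = 0); last first.
  by exists q => // i; rewrite ltnS leq_eqVlt => /predU1P[-> //|/qp].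
(* The complement of q splits the same projections, and p n, being orthogonal to q, lies below
   it. *)
apply: main (projection_compl qP) _ pn0 _; last by rewrite mulrBr mulr1 pnq0 subr0.
move=> i /qp h /h[pq0 pqp]; rewrite mulrBr mulr1; split.
  by move=> /eqP; rewrite subr_eq0 => /eqP/esym.
by move=> /eqP; rewrite subr_eq addrC -subr_eq subrr => /eqP/esym.
Qed.

End CStarProjections.

(** * Semantics of formulas *)

Section IsomorphicStructures.
Variables (R : realType) (M N : lstructure R) (f : M -> N).
Hypothesis f_bij : bijective f.
Hypothesis f0 : f (lzero M) = lzero N.
Hypothesis f1 : f (lone M) = lone N.
Hypothesis f_norm : forall x, lnorm (f x) = lnorm x.
Hypothesis fD : forall x y, f (ladd x y) = ladd (f x) (f y).
Hypothesis fM : forall x y, f (lmul x y) = lmul (f x) (f y).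
Hypothesis fZ : forall a x, f (lscale a x) = lscale a (f x).
Hypothesis f_star : forall x, f (lstar x) = lstar (f x).

Lemma teval_iso n (t : lterm R n) v : teval t (f \o v) = f (teval t v).
Proof.
by elim: t => //= [s -> t ->|a t ->|s -> t ->|t ->]; rewrite ?fD ?fZ ?fM ?f_star.
Qed.

Lemma quantifier_iso n (F : ('I_n.+1 -> N) -> R) (G : ('I_n.+1 -> M) -> R) r v :
  (forall w, F (f \o w) = G w) ->
  [set F (extend y (f \o v)) | y in [set y : N | lnorm y <= r]] =
  [set G (extend x v) | x in [set x : M | lnorm x <= r]].
Proof.
move=> FG; have [g fK gK] := f_bij.
have fE x : extend (f x) (f \o v) = f \o extend x v.
  by apply/funext => i; rewrite /extend /=; case: (unlift ord0 i).
apply/seteqP; split => _ [x /= xr <-].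
- exists (g x); first by rewrite /= -f_norm gK.
  by rewrite -FG -fE gK.
- by exists (f x); [rewrite /= f_norm|rewrite fE FG].
Qed.

Lemma feval_iso n (phi : lformula R n) v : feval phi (f \o v) = feval phi v.
Proof.
elim: phi v => {n} [n t|n k h ch psi IH|n r psi IH|n r psi IH] v /=.
- by rewrite teval_iso f_norm.
- by congr h; apply/rowP => i; rewrite !mxE IH.
- by rewrite (quantifier_iso _ _ IH).
- by rewrite (quantifier_iso _ _ IH).
Qed.

End IsomorphicStructures.

Lemma seval_iso (R : realType) (M N : lstructure R) (s : lsentence R) :
  lisomorphic M N -> seval N s = seval M s.
Proof.
move=> [f [f_bij [f0 f1 fn [fD fM fZ fs]]]]; rewrite /seval -f0.
exact: (feval_iso f_bij f0 f1 fn fD fM fZ fs s (fun=> lzero M)).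
Qed.

Lemma models_iso (R : realType) (M N : lstructure R) (T : set (lsentence R)) :
  lisomorphic M N -> models M T -> models N T.
Proof. by move=> MN MT s Ts; rewrite (seval_iso s MN) MT. Qed.

Section BoundedFormulas.
Variables (R : realType) (M : lstructure R).

Lemma teval_bounded n (t : lterm R n) (b : R) : exists C : R,
  forall v : 'I_n -> M, (forall i, lnorm (v i) <= b) -> lnorm (teval t v) <= C.
Proof.
elim: t => [i|||s [C sC] t [D tD]|a t [C tC]|s [C sC] t [D tD]|t [C tC]] /=.
- by exists b.
- by exists 0 => v _; rewrite lnorm_zero.
- by exists 1 => v _; exact: lnorm_one.
- exists (C + D) => v vb; apply: (le_trans (lnorm_add _ _)).
  by rewrite lerD ?sC ?tD.
- exists (complex.Re `|a| * C) => v vb; apply: (le_trans (lnorm_scale _ _)).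
  by rewrite ler_wpM2l ?tC//; have := normr_ge0 a; rewrite lecE => /andP[].
- exists (C * D) => v vb; apply: (le_trans (lnorm_mul _ _)).
  by rewrite ler_pM ?lnorm_ge0 ?sC ?tD.
- by exists C => v vb; apply: (le_trans (lnorm_star _)); exact: tC.
Qed.

(** For a connective, the values of the arguments stay in a compact box, on which a continuous
    function is bounded. The quantifiers range over balls that contain 0, so their suprema and
    infima are of nonempty bounded sets. *)
Lemma feval_bounded n (phi : lformula R n) (b : R) : exists C : R,
  forall v : 'I_n -> M, (forall i, lnorm (v i) <= b) -> `|feval phi v| <= C.
Proof.
elim: phi b => {n} [n t|n k h ch psi IH|n r psi IH|n r psi IH] b /=.
- have [C tC] := teval_bounded t b; exists C => v vb.
  by rewrite ger0_norm ?lnorm_ge0// tC.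
- pose C i := sval (cid (IH i b)).
  have CP i (v : 'I_n -> M) : (forall j, lnorm (v j) <= b) -> `|feval (psi i) v| <= C i.
    by rewrite /C; case: cid => c /=; apply.
  have cK : compact [set x : 'rV[R]_k | forall i, `[- C i, C i]%classic (x ord0 i)].
    by apply: (@rV_compact _ _ (fun i => `[- C i, C i]%classic)) => i; exact: segment_compact.
  have := compact_bounded (continuous_compact (continuous_subspaceT ch) cK).
  move=> [D [_ hD]]; exists (D + 1) => v vb; apply: (hD (D + 1)).
    by rewrite ltrDl.
  exists (\row_i feval (psi i) v) => // i.
  by rewrite mxE /= in_itv/= -ler_norml CP.
- have [C hC] := IH (Num.max b r%:num); exists C => v vb.
  have {}hC (x : M) : lnorm x <= r%:num -> `|feval psi (extend x v)| <= C.
    move=> xr; apply: hC => i; rewrite /extend le_max.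
    by case: (unlift ord0 i) => [j|] /=; rewrite ?vb ?xr ?orbT.
  have z : lnorm (lzero M) <= r%:num by rewrite lnorm_zero.
  set S := [set _ | _ in _].
  have Sub : ubound S C by move=> _ [x /hC xC <-]; exact: ler_normlW.
  have Sz : S (feval psi (extend (lzero M) v)) by exists (lzero M).
  rewrite ler_norml ge_sup// ?andbT; last by exists (feval psi (extend (lzero M) v)).
  apply: le_trans (_ : feval psi (extend (lzero M) v) <= _).
    by have := hC _ z; rewrite ler_norml => /andP[].
  by apply: ub_le_sup => //; exists C.
- have [C hC] := IH (Num.max b r%:num); exists C => v vb.
  have {}hC (x : M) : lnorm x <= r%:num -> `|feval psi (extend x v)| <= C.
    move=> xr; apply: hC => i; rewrite /extend le_max.
    by case: (unlift ord0 i) => [j|] /=; rewrite ?vb ?xr ?orbT.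
  have z : lnorm (lzero M) <= r%:num by rewrite lnorm_zero.
  set S := [set _ | _ in _].
  have Slb : lbound S (- C).
    by move=> _ [x /hC + <-]; rewrite ler_norml => /andP[].
  have Sz : S (feval psi (extend (lzero M) v)) by exists (lzero M).
  rewrite ler_norml lb_le_inf//; last by exists (feval psi (extend (lzero M) v)).
  apply: (@le_trans _ _ (feval psi (extend (lzero M) v))).
    by apply: ge_inf => //; exists (- C).
  exact/ler_normlW/hC.
Qed.

End BoundedFormulas.

(** * The generic ultrafilter and the Skolem hull *)

(** Compactness of [-C, C] gives a cluster point, and an ultrafilter converges to each of its
    cluster points. *)
Lemma ultra_bounded_cvg (R : realType) (X : Type) (W : set_system X)
    {UW : UltraFilter W} (f : X -> R) (C : R) :
  (forall x, `|f x| <= C) -> exists l : R, f x @[x --> W] --> l.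
Proof.
move=> fC.
have WC : W (f @^-1` `[- C, C]%classic).
  by apply: filterE => x; rewrite /= in_itv/= -ler_norml fC.
have [l [_ cl]] := @segment_compact R (- C) C (f @ W) _ WC; exists l => N Nl /=.
have [//|nN] := in_ultra_setVsetC (f @^-1` N) UW.
by have [x [/= nx /nx]] := cl (~` N) N nN Nl.
Qed.

Section GenericUltrafilter.
Variables (I : Type) (lt : I -> I -> Prop) (P : Type) (i0 : I) (p0 : P).
Hypothesis lt_wf : well_founded lt.
Hypothesis lt_trans : forall a b c, lt a b -> lt b c -> lt a c.

Definition supported (T : Type) (a : I) (f : (I -> P) -> T) :=
  forall x y, (forall b, lt b a -> x b = y b) -> f x = f y.

Lemma supported_lt T a b (f : (I -> P) -> T) :
  lt a b -> supported a f -> supported b f.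
Proof. by move=> ab fa x y xy; apply: fa => c ca; apply: xy; exact: lt_trans ab. Qed.

Variable Rel : P -> P -> Prop.
Hypothesis concurrent : forall n (p : nat -> P),
  exists q, forall i, (i < n)%N -> Rel (p i) q.

(** The required sets have the finite intersection property: a point x is built by recursion on its
    coordinates, and concurrency meets the finitely many conditions on each one. F is the filter
    generated, a finite family being the first n entries of a sequence e. *)
Lemma generic_ultrafilter : exists W : set_system (I -> P), UltraFilter W /\
  forall a f, supported a f -> W [set x | Rel (f x) (x a)].
Proof.
pose F : set_system (I -> P) := [set S |
  exists n (e : nat -> I * ((I -> P) -> P)), (forall i, supported (e i).1 (e i).2) /\
    forall x, (forall i, (i < n)%N -> Rel ((e i).2 x) (x (e i).1)) -> S x].
have FF : ProperFilter F.
  apply: Build_ProperFilter_ex.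
    move=> S [n [e [es eS]]].
    pose Q a (g : I -> P) y := forall i, (i < n)%N -> (e i).1 = a -> Rel ((e i).2 g) y.
    (* Each coordinate is chosen after the smaller ones, on which the functions
       constraining it depend. *)
    have [x xP] : exists x, forall a, Q a x (x a).
      apply: (wf_choice p0 lt_wf) => [a g g' y gg' Qy i ni eia|a g].
        rewrite -(es i g g'); first exact: Qy.
        by rewrite eia.
      have [q qP] := concurrent n (fun i => (e i).2 g).
      by exists q => i ni _; exact: qP.
    by exists x; apply: eS => i ni; exact: xP.
  split.
  - by exists 0%N, (fun=> (i0, fun=> p0)); split.
  - move=> S T [n [e [es eS]]] [m [d [ds dT]]].
    exists (n + m)%N, (fun i => if (i < n)%N then e i else d (i - n)%N); split.
      by move=> i; case: ifP.
    move=> x h; split.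
      by apply: eS => i ni; have := h i (ltn_addr _ ni); rewrite ni.
    apply: dT => i mi; have := h (n + i)%N; rewrite ltn_add2l => /(_ mi).
    by rewrite ltnNge leq_addr /= addKn.
  - by move=> S T ST [n [e [es eS]]]; exists n, e; split=> // x /eS/ST.
have [W [UW FW]] := ultraFilterLemma FF; exists W; split=> // a f fa; apply: FW.
by exists 1%N, (fun=> (a, f)); split=> // x /(_ 0%N); exact.
Qed.

End GenericUltrafilter.

(* HGen a is the a-th coordinate function, HLim chooses limits of fast Cauchy
   sequences, HClip r retracts to the ball of radius r, and HWit b phi r k chooses
   witnesses up to 1 / (k + 1) for the supremum (b = true) or infimum of phi. *)
Inductive hull_op (R : realType) (I : Type) :=
| HGen of I
| HZero
| HOne
| HAdd
| HScale of R[i]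
| HMul
| HStar
| HLim
| HClip of {posnum R}
| HWit of bool & {n & lformula R n.+1} & {posnum R} & nat.

Lemma small_hull_op (R : realType) (I : Type) : small I -> small (hull_op R I).
Proof.
move=> sI.
have inj2 := Eqdep_dec.inj_pair2_eq_dec nat (@eq_comparable nat).
have sphi : small {n & lformula R n.+1}.
  apply: (embedsW (f := fun p : {n & lformula R n.+1} =>
    existT (lformula R) (tag p).+1 (tagged p))); last exact: small_formula.
  move=> [n phi] [m psi] /= h; have [nm] := congr1 tag h.
  by case: _ / nm psi h => psi h; have -> := inj2 _ _ _ _ h.
apply: (embedsW (B := nat + I + R[i] + ({posnum R} +
    bool * {n & lformula R n.+1} * {posnum R} * nat))
  (f := fun o => match o with
  | HGen a => inl (inl (inr a))
  | HZero => inl (inl (inl 0%N))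
  | HOne => inl (inl (inl 1%N))
  | HAdd => inl (inl (inl 2%N))
  | HScale c => inl (inr c)
  | HMul => inl (inl (inl 3%N))
  | HStar => inl (inl (inl 4%N))
  | HLim => inl (inl (inl 5%N))
  | HClip r => inr (inl r)
  | HWit b phi r k => inr (inr (b, phi, r, k))
  end)).
  by move=> [a||||c||||r|b phi r k] [a'||||c'||||r'|b' phi' r' k'] //= [] => [->|->|->|-> -> -> ->].
have snat := small_count nat.
apply: small_sum; last first.
  apply: small_sum; first exact: small_posnum.
  have sbphi : small (bool * {n & lformula R n.+1}).
    exact: small_prod (small_count _) sphi.
  exact: small_prod (small_prod sbphi (small_posnum R)) snat.
by apply: small_sum; [exact: small_sum|exact: small_complex].
Qed.

Definition projections (R : realType) (A : cstarAlgType R) := {p : A | is_projection p}.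

Section Hull.
Variables (R : realType) (A : cstarAlgType R) (I : Type).
Local Notation P := (projections A).
Local Notation X := (I -> P).
Local Notation M := (lstructure_of A).
Local Notation tree := (tree (hull_op R I)).

Let plim_ex (u : nat -> A) : exists l, forall n,
  (forall i, (i < n)%N -> cnorm (u i - u i.+1) <= 1 / 2 ^+ i) ->
  cnorm (l - u n) <= 2 * 1 / 2 ^+ n.
Proof.
apply: (pseudo_limit _ cnorm_distC cnorm_distD (@cnorm_complete R A) u ler01) => x.
by rewrite subrr cnorm0.
Qed.

(** The bound at n depends on the first n estimates only. This matters because W need not be
    countably complete: finitely many estimates hold together on a set in W, while all of them may
    hold together on none. *)
Definition plim u := sval (cid (plim_ex u)).

Lemma plimP u n : (forall i, (i < n)%N -> cnorm (u i - u i.+1) <= 1 / 2 ^+ i) ->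
  cnorm (plim u - u n) <= 2 / 2 ^+ n.
Proof. by rewrite /plim; case: cid => l /= h /h; rewrite mulr1. Qed.

Let clip_ex (r : {posnum R}) (x : A) : exists y,
  cnorm y <= r%:num /\ cnorm (x - y) <= Num.max 0 (cnorm x - r%:num).
Proof.
have [xr|xr] := leP (cnorm x) r%:num.
  by exists x; rewrite subrr cnorm0 le_max lexx.
have x0 : 0 < cnorm x by apply: lt_trans xr.
pose c := r%:num / cnorm x.
have c0 : 0 <= c by rewrite divr_ge0// ltW.
have normC (d : R) : 0 <= d -> complex.Re `|d%:C%C| = d.
  by move=> d0; rewrite normc_def /= expr0n addr0 sqrtr_sqr ger0_norm.
exists (c%:C%C *: x); split.
  by rewrite cnormZ normC// mulfVK// gt_eqF.
have -> : x - c%:C%C *: x = (1 - c)%:C%C *: x.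
  by rewrite rmorphB rmorph1 scalerBl scale1r.
rewrite cnormZ normC.
  by rewrite mulrBl mul1r mulfVK ?gt_eqF// le_max lexx orbT.
by rewrite subr_ge0 ler_pdivrMr// mul1r ltW.
Qed.

Definition clip r x := sval (cid (clip_ex r x)).

Lemma clip_le r x : cnorm (clip r x) <= r%:num.
Proof. by rewrite /clip; case: cid => y []. Qed.

Lemma clip_dist r x : cnorm (x - clip r x) <= Num.max 0 (cnorm x - r%:num).
Proof. by rewrite /clip; case: cid => y []. Qed.

(** The sign treats both quantifiers at once, an infimum being the negative of the supremum of the
    negatives. *)
Definition signed_value (b : bool) n (phi : lformula R n) (v : 'I_n -> M) : R :=
  if b then feval phi v else - feval phi v.

Lemma feval_extend_bounded (N : lstructure R) n (phi : lformula R n.+1)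
    (v : 'I_n -> N) (r : R) : exists C : R,
  forall y : N, lnorm y <= r -> `|feval phi (extend y v)| <= C.
Proof.
have [C hC] := feval_bounded N phi (Num.max r (\big[Num.max/0]_i lnorm (v i))).
exists C => y yr; apply: hC => i; rewrite /extend le_max.
case: (unlift ord0 i) => [j|] /=; last by rewrite yr.
by rewrite (le_bigmax _ (fun i => lnorm (v i)) j) orbT.
Qed.

Let witness_ex (b : bool) (phi : {n & lformula R n.+1}) (r : {posnum R}) (k : nat)
  (v : 'I_(tag phi) -> M) : exists y : M, lnorm y <= r%:num /\
  forall z : M, lnorm z <= r%:num ->
    signed_value b (tagged phi) (extend z v) <=
    signed_value b (tagged phi) (extend y v) + k.+1%:R^-1.
Proof.
have [C hC] := feval_extend_bounded (tagged phi) v r%:num.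
pose S := [set signed_value b (tagged phi) (extend y v) |
  y in [set y : M | lnorm y <= r%:num]].
have hS : has_sup S.
  split; first by exists (signed_value b (tagged phi) (extend (lzero M) v));
    exists (lzero M) => //=; rewrite cnorm0.
  exists C => _ [y /= yr <-]; have := hC y yr; rewrite ler_norml /signed_value.
  by case: (b) => /andP[] //; rewrite lerNl.
have [|_ [y /= yr <-] h] := @sup_adherent R S k.+1%:R^-1 _ hS; first by rewrite invr_gt0.
exists y; split=> // z zr; rewrite -lerBlDr.
rewrite ltW// (le_lt_trans _ h)// lerB//; apply: ub_le_sup; first exact: hS.2.
by exists z.
Qed.

Definition witness b phi r k v := sval (cid (@witness_ex b phi r k v)).

Lemma witness_le b phi r k v : cnorm (@witness b phi r k v) <= r%:num.
Proof. by rewrite /witness; case: cid => y []. Qed.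

Lemma witnessP b phi r k v (z : A) : cnorm z <= r%:num ->
  signed_value b (tagged phi) (extend (z : M) v) <=
  signed_value b (tagged phi) (extend (@witness b phi r k v) v) + k.+1%:R^-1.
Proof. by rewrite /witness; case: cid => y [_ h] /= /h. Qed.

Definition op_value (o : hull_op R I) (x : X) (u : nat -> A) : A :=
  match o with
  | HGen a => sval (x a)
  | HZero => 0
  | HOne => 1
  | HAdd => u 0%N + u 1%N
  | HScale c => c *: u 0%N
  | HMul => u 0%N * u 1%N
  | HStar => star (u 0%N)
  | HLim => plim u
  | HClip r => clip r (u 0%N)
  | HWit b phi r k => @witness b phi r k (fun i => u i)
  end.

Fixpoint tree_value (t : tree) (x : X) : A :=
  match t with
  | Leaf => 0
  | Node o s => op_value o x (fun n => tree_value (s n) x)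
  end.

(** The bound is uniform in x, so that norms of tree values have limits along W. For [HLim] it comes
    from [plimP] at n = 0, where no estimate is presupposed. *)
Lemma tree_value_bounded t : exists C : R, forall x, cnorm (tree_value t x) <= C.
Proof.
elim: t => [|o s IH]; first by exists 0 => x; rewrite cnorm0.
have [C0 h0] := IH 0%N; have [C1 h1] := IH 1%N.
case: o => [a||||c||||r|b phi r k] /=.
- by exists 1 => x; exact: projection_norm_le1 (svalP (x a)).
- by exists 0 => x; rewrite cnorm0.
- by exists 1 => x; rewrite cnorm1.
- by exists (C0 + C1) => x; apply: (le_trans (cnormD _ _)); rewrite lerD.
- exists (complex.Re `|c| * C0) => x; rewrite cnormZ ler_wpM2l//.
  by have := normr_ge0 c; rewrite lecE => /andP[].
- by exists (C0 * C1) => x; rewrite (le_trans (cnormM _ _))// ler_pM ?cnorm_ge0.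
- by exists C0 => x; rewrite cnorm_star.
- exists (2 + C0) => x; set u := fun n => _.
  have := @plimP u 0%N; rewrite expr0 divr1 => /(_ (fun i (h : (i < 0)%N) =>
    False_ind _ (notF h))) h.
  rewrite -(subrK (u 0%N) (plim u)) (le_trans (cnormD _ _))// lerD//.
  exact: h0.
- by exists r%:num => x; exact: clip_le.
- by exists r%:num => x; exact: witness_le.
Qed.

Variable lt : I -> I -> Prop.
Hypothesis lt_trans : forall a b c, lt a b -> lt b c -> lt a c.
Hypothesis lt_bounded : forall f : nat -> I, exists a, forall n, lt (f n) a.

(** A node has countably many children, and countable subsets of I are bounded. Entry 0 of the
    sequence to be bounded is reserved for the coordinate named by [HGen]. *)
Lemma tree_value_supported t : I -> exists a, supported lt a (tree_value t).
Proof.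
move=> i0; elim: t => [|o s IH]; first by exists i0 => x y _.
pose f n := sval (cid (IH n)).
have fP n : supported lt (f n) (tree_value (s n)) by rewrite /f; case: cid.
have [a fa] := lt_bounded (fun n => if n is n'.+1 then f n' else
  if o is HGen b then b else i0).
exists a => x y xy /=.
have -> : (fun n => tree_value (s n) x) = (fun n => tree_value (s n) y).
  apply/funext => n; apply: (supported_lt lt_trans (fa n.+1) (fP n)) xy.
case: o fa => //= b fa; rewrite xy//.
exact: (fa 0%N).
Qed.

End Hull.

(** * The hull as a metric structure *)

Section HullStructure.
Variables (R : realType) (A : cstarAlgType R) (I : Type).
Local Notation P := (projections A).
Variable W : set_system (I -> P).
Context {UW : UltraFilter W}.
Local Notation X := (I -> P).
Local Notation M := (lstructure_of A).
Local Notation tree := (tree (hull_op R I)).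
Local Notation val t x := (@tree_value R A I t x).

Definition hull_equiv (t s : tree) :=
  cnorm (val t x - val s x) @[x --> W] --> (0 : R).

Lemma hull_equiv_le t s (g : X -> R) :
  (forall x, cnorm (val t x - val s x) <= g x) -> g @ W --> (0 : R) ->
  hull_equiv t s.
Proof.
move=> tg g0; apply: (@squeeze_cvgr _ _ _ _ (fun=> 0) g) => //; last exact: cvg_cst.
by apply: nearW => x; rewrite cnorm_ge0 tg.
Qed.

Lemma limit_le (f g : X -> R) a b : f @ W --> a -> g @ W --> b ->
  (forall x, f x <= g x) -> a <= b.
Proof.
move=> fa gb fg; rewrite -subr_ge0.
by apply: (cvgr_to_ge (cvgB gb fa)); apply: nearW => x; rewrite subr_ge0 fg.
Qed.

Lemma cvg0D (f g : X -> R) : f @ W --> (0 : R) -> g @ W --> (0 : R) ->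
  f x + g x @[x --> W] --> (0 : R).
Proof. by move=> f0 g0; rewrite -(addr0 0); exact: cvgD. Qed.

Lemma cvg0M (f : X -> R) (C : R) : f @ W --> (0 : R) ->
  C * f x @[x --> W] --> (0 : R).
Proof. by move=> f0; rewrite -(mulr0 C); apply: cvgM => //; exact: cvg_cst. Qed.

Lemma hull_equiv_refl t : hull_equiv t t.
Proof.
apply: (@hull_equiv_le _ _ (fun=> 0)); last exact: cvg_cst.
by move=> x; rewrite subrr cnorm0.
Qed.

Lemma hull_equiv_sym t s : hull_equiv t s -> hull_equiv s t.
Proof. by move=> ts; apply: (hull_equiv_le _ ts) => x; rewrite cnorm_distC. Qed.

Lemma hull_equiv_trans t s r : hull_equiv t s -> hull_equiv s r -> hull_equiv t r.
Proof.
move=> ts sr; apply: (hull_equiv_le _ (cvg0D ts sr)) => x.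
exact: cnorm_distD.
Qed.

Definition hull := {Q : set tree | exists t, Q = hull_equiv t}.

Definition hull_class (t : tree) : hull := exist _ (hull_equiv t) (ex_intro _ t erefl).

Definition hull_repr (k : hull) : tree := sval (cid (svalP k)).

Lemma hull_class_eq t s : hull_class t = hull_class s <-> hull_equiv t s.
Proof.
split=> [[ts]|ts].
  by have := hull_equiv_refl s; rewrite -[hull_equiv s s]/(_ s) -ts.
apply: eq_sig_hprop => /= [Q|]; first exact: Prop_irrelevance.
apply/seteqP; split=> r /=; first exact/hull_equiv_trans/hull_equiv_sym.
exact: hull_equiv_trans.
Qed.

Lemma hull_reprK : cancel hull_repr hull_class.
Proof.
move=> [Q QP]; apply: eq_sig_hprop => /= [Q'|]; first exact: Prop_irrelevance.
by rewrite /hull_repr; case: cid.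
Qed.

Lemma hull_classK t : hull_equiv (hull_repr (hull_class t)) t.
Proof. exact/hull_class_eq/hull_reprK. Qed.

Lemma hull_classW (Q : hull -> Prop) : (forall t, Q (hull_class t)) -> forall k, Q k.
Proof. by move=> h k; rewrite -[k]hull_reprK. Qed.

Definition node0 o : tree := Node o (fun=> Leaf).
Definition node1 o (t : tree) : tree := Node o (fun=> t).
Definition node2 o (t s : tree) : tree := Node o (fun n => if n is 0%N then t else s).

Definition hull_zero := hull_class (node0 (@HZero R I)).
Definition hull_one := hull_class (node0 (@HOne R I)).
Definition hull_add k l :=
  hull_class (node2 (@HAdd R I) (hull_repr k) (hull_repr l)).
Definition hull_scale c k := hull_class (node1 (HScale I c) (hull_repr k)).
Definition hull_mul k l :=
  hull_class (node2 (@HMul R I) (hull_repr k) (hull_repr l)).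
Definition hull_star k := hull_class (node1 (@HStar R I) (hull_repr k)).
Definition hull_norm (k : hull) : R := lim (cnorm (val (hull_repr k) x) @[x --> W]).

Lemma hull_addE t s :
  hull_add (hull_class t) (hull_class s) = hull_class (node2 (@HAdd R I) t s).
Proof.
apply/hull_class_eq.
apply: (hull_equiv_le _ (cvg0D (hull_classK t) (hull_classK s))) => x /=.
by rewrite opprD addrACA cnormD.
Qed.

Lemma hull_scaleE c t :
  hull_scale c (hull_class t) = hull_class (node1 (HScale I c) t).
Proof.
apply/hull_class_eq.
apply: (hull_equiv_le _ (cvg0M (complex.Re `|c|) (hull_classK t))) => x /=.
by rewrite -scalerBr cnormZ.
Qed.

Lemma hull_starE t :
  hull_star (hull_class t) = hull_class (node1 (@HStar R I) t).
Proof.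
apply/hull_class_eq; have := hull_classK t.
by move=> h; apply: (hull_equiv_le _ h) => x /=; rewrite -starB cnorm_star.
Qed.

Lemma hull_mulE t s :
  hull_mul (hull_class t) (hull_class s) = hull_class (node2 (@HMul R I) t s).
Proof.
apply/hull_class_eq.
have [C hC] := @tree_value_bounded R A I t.
have [D hD] := @tree_value_bounded R A I (hull_repr (hull_class s)).
apply: (hull_equiv_le _ (cvg0D (cvg0M D (hull_classK t)) (cvg0M C (hull_classK s)))).
move=> x /=.
set a := val _ x; set b := val _ x; set c := val t x; set d := val s x.
have -> : a * b - c * d = (a - c) * b + c * (b - d).
  by rewrite mulrBl mulrBr addrA subrK.
apply: (le_trans (cnormD _ _)); rewrite lerD//.
  by rewrite mulrC (le_trans (cnormM _ _))// ler_wpM2l ?cnorm_ge0 ?hD.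
by rewrite (le_trans (cnormM _ _))// ler_wpM2r ?cnorm_ge0 ?hC.
Qed.

(** The limit for the chosen representative exists by boundedness, and equivalent trees have the
    same limit. *)
Lemma hull_norm_cvg t : cnorm (val t x) @[x --> W] --> hull_norm (hull_class t).
Proof.
set s := hull_repr (hull_class t).
have [C hC] := @tree_value_bounded R A I s.
have [l sl] : exists l : R, cnorm (val s x) @[x --> W] --> l.
  by apply: (@ultra_bounded_cvg _ _ W _ _ C) => x; rewrite ger0_norm ?cnorm_ge0.
have -> : hull_norm (hull_class t) = l by exact: cvg_lim.
have ts0 : cnorm (val t x) - cnorm (val s x) @[x --> W] --> (0 : R).
  apply/cvgr0Pnorm_le => e e0.
  have /cvgr0Pnorm_le/(_ e e0) := hull_classK t.
  apply: filterS => x; rewrite ger0_norm ?cnorm_ge0// => h.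
  apply: le_trans h; rewrite cnorm_distC.
  by have := @cnorm_lip R A (val t x) (val s x); rewrite scaleN1r.
have -> : (fun x => cnorm (val t x)) =
    (fun x => (cnorm (val t x) - cnorm (val s x)) + cnorm (val s x)).
  by apply/funext => x; rewrite subrK.
by rewrite -[l]add0r; exact: cvgD.
Qed.

Arguments hull_norm_cvg t : clear implicits.

Lemma hull_norm_le t (C : R) : (forall x, cnorm (val t x) <= C) ->
  hull_norm (hull_class t) <= C.
Proof. by move=> h; apply: (cvgr_to_le (hull_norm_cvg t)); exact: nearW. Qed.

Local Notation hd k l := (hull_norm (hull_add k (hull_scale (-1) l))).

Lemma hull_dist_cvg t s :
  cnorm (val t x - val s x) @[x --> W] --> hd (hull_class t) (hull_class s).
Proof.
rewrite hull_scaleE hull_addE; have h := hull_norm_cvg (node2 (@HAdd R I) t (node1 (HScale I (-1)) s)).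
by move: h; under eq_fun do rewrite /= scaleN1r.
Qed.

Arguments hull_dist_cvg t s : clear implicits.

Lemma hull_dist_eq0 k l : hd k l = 0 <-> k = l.
Proof.
elim/hull_classW: k => t; elim/hull_classW: l => s; split=> [h|/hull_class_eq h].
  by apply/hull_class_eq; have := hull_dist_cvg t s; rewrite h.
exact: norm_cvg_unique (hull_dist_cvg t s) h.
Qed.

Lemma hull_dist_sym k l : hd k l = hd l k.
Proof.
elim/hull_classW: k => t; elim/hull_classW: l => s.
apply: norm_cvg_unique (hull_dist_cvg t s) _.
have -> : (fun x => cnorm (val t x - val s x)) = (fun x => cnorm (val s x - val t x)).
  by apply/funext => x; rewrite cnorm_distC.
exact: (hull_dist_cvg s t).
Qed.

Lemma hull_dist_triangle k l m : hd k m <= hd k l + hd l m.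
Proof.
elim/hull_classW: k => t; elim/hull_classW: l => s; elim/hull_classW: m => r.
apply: (limit_le (hull_dist_cvg t r) (cvgD (hull_dist_cvg t s) (hull_dist_cvg s r))).
by move=> x /=; exact: cnorm_distD.
Qed.

(** Pass to a fast Cauchy subsequence and apply [HLim] to representatives. For each n the first n
    distance estimates hold on a set in W, which suffices for the bound of [plim] at n. *)
Lemma hull_complete : cauchy_complete (fun k l => hd k l).
Proof.
move=> u cu.
have /choice[f fP] n : exists N, forall i j, (N <= i)%N -> (N <= j)%N ->
  hd (u i) (u j) < 1 / 2 ^+ n by apply: cu; rewrite divr_gt0// exprn_gt0.
(* Partial sums make the indices monotone while keeping them above f. *)
pose g n := (\sum_(i < n.+1) f i)%N.
have fg n : (f n <= g n)%N by rewrite /g big_ord_recr leq_addl.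
have gS n : (g n <= g n.+1)%N by rewrite /g [leqRHS]big_ord_recr leq_addr.
pose t n := hull_repr (u (g n)).
have tE n : hull_class (t n) = u (g n) by exact: hull_reprK.
pose l : tree := Node (@HLim R I) t.
have lt_ n : hd (hull_class l) (u (g n)) <= 2 / 2 ^+ n.
  rewrite -tE; apply: (cvgr_to_le (hull_dist_cvg l (t n))).
  have : \forall x \near W, forall i : 'I_n,
      cnorm (val (t i) x - val (t i.+1) x) <= 1 / 2 ^+ i.
    apply: filter_forall => i.
    have ht : hd (hull_class (t i)) (hull_class (t i.+1)) < 1 / 2 ^+ i.
      by rewrite !tE; apply: fP => //; apply: leq_trans (gS i).
    have hc := hull_dist_cvg (t i) (t i.+1).
    exact: cvgr_le hc _ ht.
  apply: filterS => x hx /=; apply: plimP => i ni.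
  exact: hx (Ordinal ni).
exists (hull_class l); apply/cvgr0Pnorm_le => e e0.
have : 3 / 2 ^+ n @[n --> \oo] --> (0 : R).
  under eq_fun do rewrite -exprVn.
  by apply: (@cvg_geometric R 3 2^-1); rewrite ger0_norm// invf_lt1// ltr1n.
move=> /cvgr0Pnorm_le/(_ e e0)[N _ /(_ N (leqnn _))/=].
rewrite ger0_norm ?divr_ge0 ?exprn_ge0// => Ne.
exists (f N) => // n fn /=; rewrite ger0_norm.
  apply: le_trans (hull_dist_triangle _ (u (g N)) _) _; apply: le_trans Ne.
  have -> : 3 / 2 ^+ N = 1 / 2 ^+ N + 2 / 2 ^+ N :> R by ring.
  rewrite lerD//; first by apply/ltW/fP.
  by rewrite hull_dist_sym.
rewrite -[u n]hull_reprK; apply: (cvgr_to_ge (hull_dist_cvg _ _)).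
by apply: nearW => x; exact: cnorm_ge0.
Qed.

Lemma hull_norm_ge0 k : 0 <= hull_norm k.
Proof.
elim/hull_classW: k => t; apply: (cvgr_to_ge (hull_norm_cvg t)).
by apply: nearW => x; exact: cnorm_ge0.
Qed.

Lemma hull_norm_zero : hull_norm hull_zero = 0.
Proof.
apply: norm_cvg_unique (hull_norm_cvg (node0 (@HZero R I))) _.
have -> : (fun x => cnorm (val (node0 (@HZero R I)) x)) = fun=> 0.
  by apply/funext => x; rewrite /= cnorm0.
exact: cvg_cst.
Qed.

Lemma hull_norm_one : hull_norm hull_one <= 1.
Proof.
apply: (cvgr_to_le (hull_norm_cvg _)).
by apply: nearW => x /=; rewrite cnorm1.
Qed.

Lemma hull_norm_add k l : hull_norm (hull_add k l) <= hull_norm k + hull_norm l.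
Proof.
elim/hull_classW: k => t; elim/hull_classW: l => s; rewrite hull_addE.
apply: (limit_le (hull_norm_cvg _) (cvgD (hull_norm_cvg t) (hull_norm_cvg s))).
by move=> x /=; exact: cnormD.
Qed.

Lemma hull_norm_scale c k :
  hull_norm (hull_scale c k) <= complex.Re `|c| * hull_norm k.
Proof.
elim/hull_classW: k => t; rewrite hull_scaleE.
apply: (limit_le (hull_norm_cvg _) (cvgM (cvg_cst _) (hull_norm_cvg t))).
by move=> x /=; rewrite cnormZ.
Qed.

Lemma hull_norm_mul k l : hull_norm (hull_mul k l) <= hull_norm k * hull_norm l.
Proof.
elim/hull_classW: k => t; elim/hull_classW: l => s; rewrite hull_mulE.
apply: (limit_le (hull_norm_cvg _) (cvgM (hull_norm_cvg t) (hull_norm_cvg s))).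
by move=> x /=; exact: cnormM.
Qed.

Lemma hull_norm_star k : hull_norm (hull_star k) <= hull_norm k.
Proof.
elim/hull_classW: k => t; rewrite hull_starE.
apply: (limit_le (hull_norm_cvg _) (hull_norm_cvg t)).
by move=> x /=; rewrite cnorm_star.
Qed.

Lemma hull_norm_lip k l : `|hull_norm k - hull_norm l| <= hd k l.
Proof.
elim/hull_classW: k => t; elim/hull_classW: l => s.
apply: (limit_le _ (hull_dist_cvg t s)).
  exact: cvg_norm (cvgB (hull_norm_cvg t) (hull_norm_cvg s)).
by move=> x /=; have := @cnorm_lip R A (val t x) (val s x); rewrite scaleN1r.
Qed.

Lemma hull_add_lip k k' l l' :
  hd (hull_add k l) (hull_add k' l') <= hd k k' + hd l l'.
Proof.
elim/hull_classW: k => t; elim/hull_classW: k' => t'.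
elim/hull_classW: l => s; elim/hull_classW: l' => s'; rewrite (hull_addE t s) (hull_addE t' s').
apply: (limit_le (hull_dist_cvg _ _) (cvgD (hull_dist_cvg t t') (hull_dist_cvg s s'))).
by move=> x /=; rewrite opprD addrACA cnormD.
Qed.

Lemma hull_scale_lip c k l :
  hd (hull_scale c k) (hull_scale c l) <= complex.Re `|c| * hd k l.
Proof.
elim/hull_classW: k => t; elim/hull_classW: l => s; rewrite (hull_scaleE c t) (hull_scaleE c s).
apply: (limit_le (hull_dist_cvg _ _) (cvgM (cvg_cst _) (hull_dist_cvg t s))).
by move=> x /=; rewrite -scalerBr cnormZ.
Qed.

Lemma hull_mul_lip r k k' l l' : hull_norm k <= r -> hull_norm k' <= r ->
  hull_norm l <= r -> hull_norm l' <= r ->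
  hd (hull_mul k l) (hull_mul k' l') <= r * (hd k k' + hd l l').
Proof.
move=> _ + + _; elim/hull_classW: k => t; elim/hull_classW: k' => t' t'r.
elim/hull_classW: l => s; elim/hull_classW: l' => s' sr.
have hd0 k l : 0 <= hd k l by exact: hull_norm_ge0.
apply: (@le_trans _ _ (hd (hull_class t) (hull_class t') * hull_norm (hull_class s) +
   hull_norm (hull_class t') * hd (hull_class s) (hull_class s'))); last first.
  rewrite mulrDr lerD//; last by apply: ler_wpM2r.
  by rewrite mulrC; apply: ler_wpM2r.
rewrite (hull_mulE t s) (hull_mulE t' s').
apply: (limit_le (hull_dist_cvg _ _) (cvgD
  (cvgM (hull_dist_cvg t t') (hull_norm_cvg s))
  (cvgM (hull_norm_cvg t') (hull_dist_cvg s s')))).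
move=> x /=.
set a := val t x; set b := val s x; set c := val t' x; set d := val s' x.
have -> : a * b - c * d = (a - c) * b + c * (b - d).
  by rewrite mulrBl mulrBr addrA subrK.
by rewrite (le_trans (cnormD _ _))// lerD// cnormM.
Qed.

Lemma hull_star_lip k l : hd (hull_star k) (hull_star l) <= hd k l.
Proof.
elim/hull_classW: k => t; elim/hull_classW: l => s; rewrite (hull_starE t) (hull_starE s).
apply: (limit_le (hull_dist_cvg _ _) (hull_dist_cvg t s)).
by move=> x /=; rewrite -starB cnorm_star.
Qed.

Definition hull_structure : lstructure R :=
  @LStructure R hull hull_zero hull_one hull_add hull_scale hull_mul hull_star
    hull_norm hull_dist_eq0 hull_dist_sym hull_dist_triangle hull_complete
    hull_norm_ge0 hull_norm_zero hull_norm_one hull_norm_add hull_norm_scale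
    hull_norm_mul hull_norm_star hull_norm_lip hull_add_lip hull_scale_lip
    hull_mul_lip hull_star_lip.

End HullStructure.

Arguments hull_norm_cvg {R A I} W {UW} t.
Arguments hull_dist_cvg {R A I} W {UW} t s.

(** * The theorem of Los for the hull *)

Section Los.
Variables (R : realType) (A : cstarAlgType R) (I : Type).
Local Notation P := (projections A).
Variable W : set_system (I -> P).
Context {UW : UltraFilter W}.
Local Notation X := (I -> P).
Local Notation M := (lstructure_of A).
Local Notation K := (@hull_structure R A I W UW).
Local Notation tree := (tree (hull_op R I)).
Local Notation val t x := (@tree_value R A I t x).
Local Notation cls t := (hull_class W t).

Lemma near_le (f : X -> R) (a z : R) : f @ W --> a -> a < z -> \forall x \near W, f x <= z.
Proof. by move=> fa az; apply: cvgr_le fa _ az. Qed.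

Lemma near_ge (f : X -> R) (a z : R) : f @ W --> a -> z < a -> \forall x \near W, z <= f x.
Proof. by move=> fa az; apply: cvgr_ge fa _ az. Qed.

Fixpoint term_tree n (t : lterm R n) (v : 'I_n -> tree) : tree :=
  match t with
  | TVar i => v i
  | TZero => node0 (@HZero R I)
  | TOne => node0 (@HOne R I)
  | TAdd s t => node2 (@HAdd R I) (term_tree s v) (term_tree t v)
  | TScale c t => node1 (HScale I c) (term_tree t v)
  | TMul s t => node2 (@HMul R I) (term_tree s v) (term_tree t v)
  | TStar t => node1 (@HStar R I) (term_tree t v)
  end.

Lemma term_tree_value n (t : lterm R n) v x :
  val (term_tree t v) x = teval (M := M) t (fun i => val (v i) x).
Proof. by elim: t => //= [s -> t ->|c t ->|s -> t ->|t ->]. Qed.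

Lemma term_tree_class n (t : lterm R n) v :
  teval (M := K) t (fun i => cls (v i)) = cls (term_tree t v).
Proof.
elim: t => //= [s -> t ->|c t ->|s -> t ->|t ->].
- exact: hull_addE.
- exact: hull_scaleE.
- exact: hull_mulE.
- exact: hull_starE.
Qed.

(** An element of the ball of radius r thus has a representative with all its values in the ball of
    A, not just nearly so along W. *)
Lemma clip_equiv (r : {posnum R}) t : hull_norm (cls t) <= r%:num ->
  hull_equiv W t (node1 (HClip I r) t).
Proof.
move=> tr; rewrite /hull_equiv; apply/cvgr0Pnorm_le => e e0.
have tre : hull_norm (cls t) < r%:num + e by rewrite (le_lt_trans tr)// ltrDl.
have h := near_le (@hull_norm_cvg R A I W UW t) tre.
apply: filterS h => x /= xr; rewrite ger0_norm ?cnorm_ge0//.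
apply: (le_trans (clip_dist r _)); rewrite ge_max (ltW e0) lerBlDr addrC.
exact: xr.
Qed.

(** A nearly optimal class, clipped to the ball, bounds the pointwise suprema from below. A witness
    tree, optimal up to 1 / (m + 1) at every x, bounds them from above. *)
Lemma sup_los (F : A -> X -> R) (G : hull W -> R) (r : {posnum R}) :
  (forall t, F (val t x) x @[x --> W] --> G (cls t)) ->
  (forall x, exists C, forall y, cnorm y <= r%:num -> F y x <= C) ->
  (exists C, forall k, hull_norm k <= r%:num -> G k <= C) ->
  (forall m : nat, exists t, forall x, cnorm (val t x) <= r%:num /\
     forall y, cnorm y <= r%:num -> F y x <= F (val t x) x + m.+1%:R^-1) ->
  sup [set F y x | y in [set y | cnorm y <= r%:num]] @[x --> W] -->
  sup [set G k | k in [set k | hull_norm k <= r%:num]].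
Proof.
move=> FG Fb [C GC] wit.
set s := sup [set G k | k in _].
have Gsup : has_sup [set G k | k in [set k | hull_norm k <= r%:num]].
  split; first by exists (G (hull_zero W)), (hull_zero W) => //=; rewrite hull_norm_zero.
  by exists C => _ [k kr <-]; exact: GC.
have Fsup x : has_sup [set F y x | y in [set y | cnorm y <= r%:num]].
  split; first by exists (F 0 x), 0 => //=; rewrite cnorm0.
  by have [D hD] := Fb x; exists D => _ [y yr <-]; exact: hD.
apply/cvgrPdist_le => e e0.
have e20 : 0 < e / 2 by rewrite divr_gt0.
have [_ [k kr <-] sk] := sup_adherent e20 Gsup.
have lower : \forall x \near W,
    s - e <= sup [set F y x | y in [set y | cnorm y <= r%:num]].
  pose t := node1 (HClip I r) (hull_repr k).
  have tk : cls t = k.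
    rewrite -[RHS]hull_reprK; apply/esym/hull_class_eq/clip_equiv.
    by rewrite hull_reprK.
  have /(near_ge (FG t)) : s - e < G (cls t).
    by rewrite tk; apply: lt_trans sk; rewrite ltrD2l ltrN2; lra.
  apply: filterS => x h; apply: (le_trans h); apply: ub_le_sup; first exact: (Fsup x).2.
  by exists (val t x) => //; exact: clip_le.
have upper : \forall x \near W,
    sup [set F y x | y in [set y | cnorm y <= r%:num]] <= s + e.
  have [m _ /(_ m (leqnn m))/= me] : \forall m \near \oo, m.+1%:R^-1 < e / 2.
    exact: (near_infty_natSinv_lt (PosNum e20)).
  have [t tP] := wit m.
  have ts : G (cls t) <= s.
    apply: ub_le_sup; first exact: Gsup.2.
    by exists (cls t) => //=; apply: hull_norm_le => x; exact: (tP x).1.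
  have tse : G (cls t) < s + e / 2 by rewrite (le_lt_trans ts)// ltrDl.
  have := near_le (FG t) tse.
  apply: filterS => x xs; apply: ge_sup; first exact: (Fsup x).1.
  move=> _ [y yr <-]; apply: (le_trans ((tP x).2 y yr)).
  have -> : s + e = s + e / 2 + e / 2 by lra.
  by rewrite lerD// ltW.
apply: filterS2 lower upper => x l u.
by rewrite ler_distl; lra.
Qed.

Definition extend_tree n (s : tree) (t : 'I_n -> tree) (i : 'I_n.+1) : tree :=
  oapp t s (unlift ord0 i).

Lemma extend_tree_value n s (t : 'I_n -> tree) x :
  extend (M := M) (val s x) (fun i => val (t i) x) =
  fun i => val (extend_tree s t i) x.
Proof.
by apply/funext => i; rewrite /extend /extend_tree; case: (unlift ord0 i).
Qed.

Lemma extend_tree_class n s (t : 'I_n -> tree) :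
  extend (M := K) (cls s) (fun i => cls (t i)) = fun i => cls (extend_tree s t i).
Proof.
by apply/funext => i; rewrite /extend /extend_tree; case: (unlift ord0 i).
Qed.

Lemma signed_los n (b : bool) (phi : lformula R n.+1) (r : {posnum R}) (t : 'I_n -> tree) :
  (forall t : 'I_n.+1 -> tree, feval (M := M) phi (fun i => val (t i) x) @[x --> W] -->
     feval (M := K) phi (fun i => cls (t i))) ->
  let val_of (N : lstructure R) (v : 'I_n -> N) (y : N) :=
    if b then feval phi (extend y v) else - feval phi (extend y v) in
  sup [set val_of M (fun i => val (t i) x) y | y in [set y : M | lnorm y <= r%:num]]
    @[x --> W] -->
  sup [set val_of K (fun i => cls (t i)) k | k in [set k : K | lnorm k <= r%:num]].
Proof.
move=> IH val_of.
apply: (@sup_los (fun y x => val_of M (fun i => val (t i) x) y)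
  (fun k => val_of K (fun i => cls (t i)) k)).
- move=> s; rewrite /val_of extend_tree_class.
  have -> : (fun x => if b then feval phi (extend (val s x : M) (fun i => val (t i) x))
       else - feval phi (extend (val s x : M) (fun i => val (t i) x))) =
     (fun x => if b then feval (M := M) phi (fun i => val (extend_tree s t i) x)
       else - feval (M := M) phi (fun i => val (extend_tree s t i) x)).
    by apply/funext => x; rewrite extend_tree_value.
  by case: (b); [exact: IH|apply: cvgN; exact: IH].
- move=> x; have [C hC] := feval_extend_bounded (N := M) phi (fun i => val (t i) x) r%:num.
  exists C => y /hC; rewrite /val_of ler_norml => /andP[? ?].
  by case: (b); rewrite // lerNl.
- have [C hC] := feval_extend_bounded (N := K) phi (fun i => cls (t i)) r%:num.
  exists C => y /hC; rewrite /val_of ler_norml => /andP[? ?].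
  by case: (b); rewrite // lerNl.
- move=> m.
  (* The parameters are the children numbered below n, and the remaining children are [Leaf]. *)
  exists (Node (HWit I b (existT _ n phi) r m) (fun i => oapp t Leaf (insub i))) => x /=.
  have -> : (fun i : 'I_n => val (oapp t Leaf (insub (nat_of_ord i))) x) =
      (fun i => val (t i) x) by apply/funext => i; rewrite valK.
  split; first exact: witness_le.
  by move=> y yr; exact: (@witnessP R A b (existT _ n phi) r m (fun i => val (t i) x) y yr).
Qed.

(** Induction on phi: norms converge by the definition of the hull norm, connectives by continuity,
    and quantifiers through Skolem witnesses. *)
Theorem hull_los n (phi : lformula R n) (t : 'I_n -> tree) :
  feval (M := M) phi (fun i => val (t i) x) @[x --> W] -->
  feval (M := K) phi (fun i => cls (t i)).
Proof.
elim: phi t => {n} [n s|n k f cf psi IH|n r psi IH|n r psi IH] t.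
- rewrite /= term_tree_class.
  have -> : (fun x => cnorm (teval (M := M) s (fun i => val (t i) x))) =
      (fun x => cnorm (val (term_tree s t) x)).
    by apply/funext => x; rewrite term_tree_value.
  exact: hull_norm_cvg.
- apply: (@cvg_comp _ _ _ (fun x => \row_i feval (M := M) (psi i) (fun j => val (t j) x)) f
    W (nbhs (\row_i feval (M := K) (psi i) (fun j => cls (t j))))); last exact: cf.
  apply/cvg_ballP => e e0.
  have : \forall x \near W, forall i : 'I_k,
      ball (feval (M := K) (psi i) (fun j => cls (t j))) e
        (feval (M := M) (psi i) (fun j => val (t j) x)).
    by apply: filter_forall => i; move: (IH i t) => /cvg_ballP/(_ e e0).
  by apply: filterS => x h; split=> // i j; rewrite !mxE.
- have h := @signed_los n true psi r t (fun t => IH t).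
  exact: h.
- have inf_sup (T : Type) (f : T -> R) (B : set T) :
      inf [set f y | y in B] = - sup [set - f y | y in B].
    by rewrite /inf image_comp.
  rewrite /= inf_sup; under eq_fun do rewrite inf_sup.
  have h := @signed_los n false psi r t (fun t => IH t).
  exact: cvgN h.
Qed.

Lemma hull_seval (s : lsentence R) : seval K s = seval M s.
Proof.
have h := @hull_los 0 s (fun i : 'I_0 => Leaf).
have nullary (T : Type) (u v : 'I_0 -> T) : u = v by apply/funext => -[].
have -> : seval K s = feval (M := K) s (fun i : 'I_0 => cls Leaf).
  by congr (feval s _); exact: nullary.
apply: norm_cvg_unique h _.
have -> : (fun x => feval (M := M) s (fun i : 'I_0 => val Leaf x)) = fun=> seval M s.
  by apply/funext => x; congr (feval s _); exact: nullary.
exact: cvg_cst.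
Qed.

End Los.

(** * Generic projections and ultrapowers *)

Section AlmostProjections.
Variables (R : realType) (A : cstarAlgType R).

(** The self-adjoint part a of y is within e/2 of y, and a^2 - a has norm at most 7e/2 because y and
    a have norm at most 2. Hence a projection lies within 14e of a. *)
Lemma near_projection_of_almost (y : A) (e : R) : e <= 1 / 100 ->
  cnorm (star y - y) <= e -> cnorm (y * y - y) <= e ->
  exists2 p, is_projection p & cnorm (y - p) <= 20 * e.
Proof.
move=> e1 ys yy; have e0 := le_trans (cnorm_ge0 _) ys.
have n0 := cnorm_ge0 y.
have n2 : cnorm y <= 2.
  have : cnorm y ^+ 2 <= e * cnorm y + e + cnorm y.
    rewrite -cstar_identity.
    have -> : star y * y = (star y - y) * y + (y * y - y) + y.
      by rewrite mulrBl !addrA !subrK.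
    apply: (le_trans (cnormD _ _)); rewrite lerD2r.
    apply: (le_trans (cnormD _ _)); rewrite lerD//.
    by rewrite (le_trans (cnormM _ _))// ler_wpM2r.
  rewrite expr2 => h; rewrite leNgt; apply/negP => y2; nra.
pose a := (2^-1 : R[i]) *: (y + star y).
have half : complex.Re `|2^-1 : R[i]| = 2^-1.
  by rewrite ger0_norm ?invr_ge0 ?ler0n// -[2]/(1 + 1) /=; field.
have sa : star a = a.
  by rewrite /a starZ starD starK addrC; congr (_ *: _); rewrite conj_Creal// ger0_real// invr_ge0 ler0n.
have ay : cnorm (a - y) <= e / 2.
  have -> : a - y = (2^-1 : R[i]) *: (star y - y).
    rewrite -[in LHS](scale1r y) /a.
    have {2}-> : (1 : R[i]) = 2^-1 + 2^-1 by field.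
    by rewrite scalerDl scalerDr scalerBr opprD addrACA subrr add0r.
  by rewrite cnormZ half mulrC ler_pM2r.
have a2 : cnorm a <= 2.
  rewrite /a cnormZ half ler_pdivrMl// (le_trans (cnormD _ _))// cnorm_star; lra.
have aa : cnorm (a * a - a) <= 7 / 2 * e.
  have -> : a * a - a = a * (a - y) + (a - y) * y + (y * y - y) - (a - y).
    by rewrite mulrBr mulrBl !addrA !subrK opprB addrA subrK.
  have h1 : cnorm (a * (a - y)) <= 2 * (e / 2).
    by rewrite (le_trans (cnormM _ _))// ler_pM ?cnorm_ge0.
  have h2 : cnorm ((a - y) * y) <= e / 2 * 2.
    by rewrite (le_trans (cnormM _ _))// ler_pM ?cnorm_ge0.
  apply: (le_trans (cnormB _ _)).
  have := cnormD (a * (a - y) + (a - y) * y) (y * y - y).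
  have := cnormD (a * (a - y)) ((a - y) * y); lra.
have [|p pP ap] := near_projection sa; first by lra.
exists p => //; apply: (le_trans (cnorm_distD _ a _)).
by rewrite cnorm_distC; lra.
Qed.

End AlmostProjections.

(** By Los the hull is a model of T, so it is isomorphic to some C*-algebra B. The map [ev]
    evaluates a tree representing an element of B, and the last clauses express norms in B as limits
    of pointwise norms in A. *)
Lemma hull_model (R : realType) (T : set (lsentence R)) (A : cstarAlgType R)
    (I : Type) (lt : I -> I -> Prop) (Rel : projections A -> projections A -> Prop) :
  theory_of_cstar T -> models (lstructure_of A) T ->
  inhabited I -> small I -> well_founded lt ->
  (forall a b c, lt a b -> lt b c -> lt a c) ->
  (forall f : nat -> I, exists a, forall n, lt (f n) a) ->
  (forall n (p : nat -> projections A), exists q, forall i, (i < n)%N -> Rel (p i) q) ->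
  exists (B : cstarAlgType R) (W : set_system (I -> projections A))
    (ev : B -> (I -> projections A) -> A) (q : I -> B),
  [/\ UltraFilter W, models (lstructure_of B) T, density_character_le B (set nat),
    [/\ forall b, exists a, supported lt a (ev b),
      forall a f, supported lt a f -> W [set x | Rel (f x) (x a)],
      forall a, is_projection (q a) &
      forall a, cnorm (ev (q a) x - sval (x a)) @[x --> W] --> (0 : R)] &
    [/\ forall b, cnorm (ev b x) @[x --> W] --> cnorm b,
      forall b c d, cnorm (ev b x * ev c x - ev d x) @[x --> W] --> cnorm (b * c - d) &
      forall b c, cnorm (star (ev b x) - ev c x) @[x --> W] --> cnorm (star b - c)]].
Proof.
move=> T_cstar AT [i0] sI lt_wf lt_trans lt_bounded conc.
have p0 : projections A by exists 0; exact: projection0.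
have [W [UW WRel]] := generic_ultrafilter i0 p0 lt_wf conc.
pose K := @hull_structure R A I W UW.
have KT : models K T by move=> s Ts; rewrite hull_seval AT.
have [B KB] := T_cstar K KT.
have BT : models (lstructure_of B) T := models_iso KB KT.
have [f [[g fK gK] [_ _ f_norm [fD fM fZ f_star]]]] := KB.
pose ev (b : B) : (I -> projections A) -> A := tree_value (hull_repr (g b)).
pose q a := f (hull_class W (node0 (HGen R a))).
exists B, W, ev, q; split=> //.
(* B itself has at most continuum many elements, because there are no more trees than that. *)
- exists [set: B]; split; first by move=> b e e0; exists b; rewrite ?subrr ?cnorm0.
  have [h hI] := small_tree (small_hull_op R sI).
  have : exists2 F : B -> set nat, set_fun [set: B] [set: set nat] F &
      {in [set: B] &, injective F}.
    exists (fun b => h (hull_repr (g b))) => // b c _ _ /hI bc.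
    by rewrite -(gK b) -(gK c) -[g b]hull_reprK -[g c]hull_reprK bc.
  by move=> /injfunPex/pcard_leP.
- split=> //.
  + move=> b; exact: tree_value_supported lt_trans lt_bounded _ i0.
  + move=> a.
    have eqcls t s : (forall x, @tree_value R A I t x = tree_value s x) ->
        hull_class W t = hull_class W s.
      move=> ts; apply/hull_class_eq.
      apply: (@hull_equiv_le _ _ _ _ _ _ _ (fun=> 0)); last exact: cvg_cst.
      by move=> x; rewrite ts subrr cnorm0.
    have [sq mq] := (hull_starE (W := W) (node0 (HGen R a)),
      hull_mulE (W := W) (node0 (HGen R a)) (node0 (HGen R a))).
    split.
      rewrite -[LHS]f_star; congr f; rewrite -[LHS]/(hull_star _) sq.
      by apply: eqcls => x /=; case: (x a) => p [].
    rewrite -[LHS]fM; congr f; rewrite -[LHS]/(hull_mul _ _) mq.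
    by apply: eqcls => x /=; case: (x a) => p [].
  + move=> a; rewrite /ev /q fK.
    exact: hull_classK.
- split.
  + move=> b; rewrite /ev -{2}(gK b) -[X in _ --> X]/(lnorm (f (g b) : lstructure_of B)) f_norm.
    by have := @hull_norm_cvg R A I W UW (hull_repr (g b)); rewrite hull_reprK.
  + move=> b c d.
    have := @hull_dist_cvg R A I W UW
      (node2 (@HMul R I) (hull_repr (g b)) (hull_repr (g c))) (hull_repr (g d)).
    rewrite -hull_mulE !hull_reprK -[hull_norm _]f_norm fD fZ fM !gK /= scaleN1r.
    exact.
  + move=> b c.
    have := @hull_dist_cvg R A I W UW
      (node1 (@HStar R I) (hull_repr (g b))) (hull_repr (g c)).
    rewrite -hull_starE !hull_reprK -[hull_norm _]f_norm fD fZ f_star !gK /= scaleN1r.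
    exact.
Qed.

(** * Generic projections act on all projections of the hull *)

Section HullProjections.
Variables (R : realType) (A B : cstarAlgType R) (I : Type) (lt : I -> I -> Prop).
Variables (W : set_system (I -> projections A)).
Context {UW : UltraFilter W}.
Variables (ev : B -> (I -> projections A) -> A) (q : I -> B).
Variable Rel : projections A -> projections A -> Prop.
Hypothesis lt_trans : forall a b c, lt a b -> lt b c -> lt a c.
Hypothesis commA : forall p q : A, is_projection p -> is_projection q -> p * q = q * p.
Hypothesis commB : forall p q : B, is_projection p -> is_projection q -> p * q = q * p.
Hypothesis ev_supported : forall b, exists a, supported lt a (ev b).
Hypothesis generic : forall a f, supported lt a f -> W [set x | Rel (f x) (x a)].
Hypothesis qP : forall a, is_projection (q a).
Hypothesis ev_q : forall a, cnorm (ev (q a) x - sval (x a)) @[x --> W] --> (0 : R).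
Hypothesis ev_norm : forall b, cnorm (ev b x) @[x --> W] --> cnorm b.
Hypothesis ev_mul : forall b c d,
  cnorm (ev b x * ev c x - ev d x) @[x --> W] --> cnorm (b * c - d).
Hypothesis ev_star : forall b c,
  cnorm (star (ev b x) - ev c x) @[x --> W] --> cnorm (star b - c).

Arguments ev_q a : clear implicits.
Arguments ev_norm b : clear implicits.
Arguments ev_mul b c d : clear implicits.
Arguments ev_star b c : clear implicits.

Let near_zero (f : (I -> projections A) -> R) (l e : R) :
  f x @[x --> W] --> l -> l = 0 -> 0 < e -> \forall x \near W, f x <= e.
Proof. by move=> fl l0 e0; apply: cvgr_le fl _ _; rewrite l0. Qed.

Let e0 : 0 < 1 / 200 :> R. Proof. by rewrite divr_gt0. Qed.

(** On a set in W the value of p satisfies the projection equations up to 1/200, so a projection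
    lies within 20/200 of it. It is chosen as a function of that value alone, and so inherits the
    support of [ev p]. *)
Lemma hull_projection_lift (p : B) : is_projection p ->
  exists a (f : (I -> projections A) -> projections A), supported lt a f /\
    \forall x \near W, cnorm (ev p x - sval (f x)) <= 1 / 10.
Proof.
move=> [sp pp]; have [a pa] := ev_supported p.
have p0 : projections A by exists 0; exact: projection0.
pose close (y : A) (r : projections A) := cnorm (y - sval r) <= 1 / 10.
pose f (y : A) := if pselect (exists r, close y r) is left h then sval (cid h) else p0.
have fP y : (exists r, close y r) -> close y (f y).
  by rewrite /f; case: pselect => // h _; case: cid.
exists a, (fun x => f (ev p x)); split; first by move=> x y xy; rewrite (pa x y xy).
have s0 : cnorm (star p - p) = 0 by rewrite sp subrr cnorm0.
have m0 : cnorm (p * p - p) = 0 by rewrite pp subrr cnorm0.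
have hs := near_zero (ev_star p p) s0 e0.
have hm := near_zero (ev_mul p p p) m0 e0.
apply: filterS2 hs hm => x xs xm; apply: fP.
have [|r rP yr] := near_projection_of_almost _ xs xm; first by lra.
by exists (exist _ r rP); rewrite /close /=; lra.
Qed.

Lemma hull_product_lift (p : B) (f : (I -> projections A) -> projections A) a :
  is_projection p ->
  (\forall x \near W, cnorm (ev p x - sval (f x)) <= 1 / 10) ->
  \forall x \near W, cnorm (ev p x * ev (q a) x - sval (f x) * sval (x a)) <= 1 / 5.
Proof.
move=> pP fp; have hq := near_zero (ev_q a) erefl e0.
have hp : \forall x \near W, cnorm (ev p x) <= 2.
  apply: cvgr_le (ev_norm p) _ _.
  by rewrite (le_lt_trans (projection_norm_le1 pP))// ltr1n.
apply: filterS3 fp hq hp => x xf xq xp.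
have -> : ev p x * ev (q a) x - sval (f x) * sval (x a) =
    ev p x * (ev (q a) x - sval (x a)) + (ev p x - sval (f x)) * sval (x a).
  by rewrite mulrBr mulrBl addrA subrK.
have h1 : cnorm (ev p x * (ev (q a) x - sval (x a))) <= 2 * (1 / 200).
  by rewrite (le_trans (cnormM _ _))// ler_pM ?cnorm_ge0.
have h2 : cnorm ((ev p x - sval (f x)) * sval (x a)) <= 1 / 10 * 1.
  rewrite (le_trans (cnormM _ _))// ler_pM ?cnorm_ge0//.
  exact: projection_norm_le1 (svalP (x a)).
by apply: (le_trans (cnormD _ _)); lra.
Qed.

(** For a above the support of a lift f of p, x a splits f x on a set in W. If p * q a were 0 or p,
    then at some x the product of f x and x a would be at distance below 1 from 0 or from f x, hence
    equal to it. *)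
Lemma generic_splits : (forall p r, Rel p r -> splits (sval r) (sval p)) ->
  forall p : B, is_projection p -> exists b, forall a, lt b a -> splits (q a) p.
Proof.
move=> RelP p pP; have [b [f [fb fp]]] := hull_projection_lift pP.
exists b => a ba p0.
have fpq := hull_product_lift a pP fp.
have rel := generic (supported_lt lt_trans ba fb).
(* A nonzero projection has norm 1, so its lift is nonzero on a set in W and [splits] is not vacuous
   there. *)
have p1 : \forall x \near W, 1 / 2 <= cnorm (ev p x).
  by apply: cvgr_ge (ev_norm p) _ _; rewrite projection_norm//; lra.
have good : \forall x \near W, sval (f x) * sval (x a) <> 0 /\
    sval (f x) * sval (x a) <> sval (f x).
  apply: filterS3 rel p1 fp => x /RelP h p1x fpx; apply: h => f0.
  by move: fpx; rewrite f0 subr0; lra.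
split=> pq.
- have c0 : cnorm (p * q a - p * q a) = 0 by rewrite subrr cnorm0.
  have h1 := near_zero (ev_mul p (q a) (p * q a)) c0 e0.
  have h2 : \forall x \near W, cnorm (ev (p * q a) x) <= 1 / 200.
    by apply: near_zero (ev_norm _) _ e0; rewrite pq cnorm0.
  have [x [[x1 x2] [x3 [x4 _]]]] := filter_ex (filterI (filterI h1 h2) (filterI fpq good)).
  apply: x4; apply: projection_eq0; first exact: projection_meet (svalP _) (svalP _).
  have : cnorm (ev p x * ev (q a) x) <= 1 / 100.
    rewrite -(subrK (ev (p * q a) x) (_ * _)).
    by apply: (le_trans (cnormD _ _)); lra.
  have := cnorm_distD 0 (ev p x * ev (q a) x) (sval (f x) * sval (x a)).
  by rewrite !sub0r !cnormN; lra.
- have c0 : cnorm (p * q a - p) = 0 by rewrite pq subrr cnorm0.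
  have h1 := near_zero (ev_mul p (q a) p) c0 e0.
  have [x [[x1 x2] [x3 [_ x4]]]] := filter_ex (filterI (filterI h1 fp) (filterI fpq good)).
  apply: x4; apply: (projection_dist commA) => //; last 2 first.
  - exact: svalP.
  - have := cnorm_distD (sval (f x) * sval (x a)) (ev p x * ev (q a) x) (sval (f x)).
    have := cnorm_distD (ev p x * ev (q a) x) (ev p x) (sval (f x)).
    by rewrite (cnorm_distC (_ * _) (ev p x * _)); lra.
  - exact: projection_meet (svalP _) (svalP _).
Qed.

(** The ultrafilter selects one alternative for f x and x a. In the limit p * q a is within 1/2 of q
    a or of 0, and projections so close coincide. *)
Lemma generic_decides : (forall p r, Rel p r -> decides (sval r) (sval p)) ->
  forall p : B, is_projection p -> exists b, forall a, lt b a -> decides (q a) p.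
Proof.
move=> RelP p pP; have [b [f [fb fp]]] := hull_projection_lift pP.
exists b => a ba.
have fpq := hull_product_lift a pP fp.
have rel := generic (supported_lt lt_trans ba fb).
have hq := near_zero (ev_q a) erefl e0.
split.
  move=> qa0.
  have h2 : \forall x \near W, cnorm (ev (q a) x) <= 1 / 200.
    by apply: near_zero (ev_norm _) _ e0; rewrite qa0 cnorm0.
  have [x [[x1 x2] /RelP[x3 _]]] := filter_ex (filterI (filterI h2 hq) rel).
  apply: x3; apply: projection_eq0; first exact: svalP.
  have := cnorm_distD 0 (ev (q a) x) (sval (x a)).
  by rewrite !sub0r !cnormN; lra.
have pqP : is_projection (p * q a) := projection_meet commB pP (qP a).
have [le|ne] := in_ultra_setVsetC [set x : I -> projections A |
  sval (f x) * sval (x a) = sval (x a)] UW.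
- left; apply: (projection_dist commB) => //.
  apply: (@le_lt_trans _ _ (1 / 2)); last by lra.
  apply: (cvgr_to_le (ev_mul p (q a) (q a))).
  apply: filterS3 le fpq hq => x /= xe x1 x2.
  have := cnorm_distD (ev p x * ev (q a) x) (sval (x a)) (ev (q a) x).
  by rewrite -{1}xe (cnorm_distC (sval (x a))); lra.
- right; apply: projection_eq0 => //.
  apply: (@le_lt_trans _ _ (1 / 2)); last by lra.
  apply: (cvgr_to_le (ev_norm (p * q a))).
  have c0 : cnorm (p * q a - p * q a) = 0 by rewrite subrr cnorm0.
  have h1 := near_zero (ev_mul p (q a) (p * q a)) c0 e0.
  apply: filterS3 (filterI ne rel) fpq h1 => x [xne /RelP[_ xd]] x1 x2.
  have x0 : sval (f x) * sval (x a) = 0 by case: xd.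
  rewrite x0 subr0 in x1.
  have := cnorm_distD 0 (ev p x * ev (q a) x) (ev (p * q a) x).
  by rewrite !sub0r !cnormN; lra.
Qed.

End HullProjections.

(** * Projections of ultrapowers *)

Section UltrapowerProjections.
Variables (R : realType) (A : cstarAlgType R).
Variable U : set_system nat.
Context {FU : UltraFilter U}.
Local Notation AU := (ultrapower A U).
Local Notation upc a := (@up_class R A U FU a).

Definition star_projection (C : numClosedFieldType) (B : starAlgType C) (x : B) :=
  star x = x /\ x * x = x.

Lemma projection_seq_bounded (p : nat -> A) :
  (forall n, is_projection (p n)) -> p \in @linf_pred R A.
Proof. by move=> pP; apply/asboolP; exists 1 => n; exact: projection_norm_le1. Qed.

Definition projection_seq (p : nat -> A) (pP : forall n, is_projection (p n)) : linf A :=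
  Linf (projection_seq_bounded pP).

Definition up_projection (p : nat -> A) (pP : forall n, is_projection (p n)) : AU :=
  upc (projection_seq pP).

Lemma up_class_eq (a b : linf A) : upc a = upc b <->
  cnorm (a n - b n) @[n --> U] --> (0 : R).
Proof.
split=> [/up_classP/asboolP//|h].
by apply/up_classP/asboolP.
Qed.

Lemma up_class_near (a b : linf A) : (\forall n \near U, a n = b n) ->
  upc a = upc b.
Proof.
move=> ab; apply/up_class_eq/cvgr0Pnorm_le => e e0.
by apply: filterS ab => n ->; rewrite subrr cnorm0 normr0 ltW.
Qed.

Lemma up_class0 : upc 0 = 0 :> AU.
Proof. by rewrite /up_class piE. Qed.

Lemma up_class_mul (a b : linf A) : upc a * upc b = upc (a * b) :> AU.
Proof. exact: up_mulE. Qed.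

Lemma up_class_star (a : linf A) : star (upc a) = upc (star a) :> AU.
Proof. exact: up_starE. Qed.

Lemma up_projectionP p (pP : forall n, is_projection (p n)) :
  star_projection (up_projection pP).
Proof.
split.
  rewrite up_class_star; congr up_class; apply/val_inj/funext => n /=.
  by case: (pP n).
rewrite up_class_mul; congr up_class; apply/val_inj/funext => n /=.
by case: (pP n).
Qed.

(** Any representing sequence satisfies the projection equations up to errors tending to 0 along U,
    so its entries can be replaced by nearby projections. *)
Lemma up_projection_lift (x : AU) : star_projection x ->
  exists p (pP : forall n, is_projection (p n)), x = up_projection pP.
Proof.
move: x; apply: (@up_classW R A U FU) => a [].
rewrite up_class_star up_class_mul => /up_class_eq sa /up_class_eq aa.
have /choice[p pP] n : exists p : A, is_projection p /\ forall e, e <= 1 / 100 ->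
    cnorm (star (a n) - a n) <= e -> cnorm (a n * a n - a n) <= e ->
    cnorm (a n - p) <= 20 * e.
  pose e := Num.max (cnorm (star (a n) - a n)) (cnorm (a n * a n - a n)).
  have [e1|e1] := leP e (1 / 100).
    have [||p pP ap] := @near_projection_of_almost R A (a n) e e1; rewrite ?le_max ?lexx ?orbT//.
    exists p; split=> // e' _ e2 e3; apply: (le_trans ap); rewrite ler_pM2l//.
    by rewrite ge_max e2.
  (* Where the error exceeds 1/100, 0 serves as default: the required estimate is vacuous there. *)
  exists 0; split; first exact: projection0.
  move=> e' e'1 e2 e3; suff : e <= e' by lra.
  by rewrite ge_max e2.
exists p, (fun n => (pP n).1); apply/up_class_eq/cvgr0Pnorm_le => e e0.
pose d := Num.min (1 / 100) (e / 20).
have d0 : 0 < d by rewrite lt_min !divr_gt0.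
move: sa aa => /cvgr0Pnorm_le/(_ d d0) sa /cvgr0Pnorm_le/(_ d d0) aa.
apply: filterS2 sa aa => n; rewrite !ger0_norm ?cnorm_ge0//= => sn an.
have := (pP n).2 d _ sn an; rewrite ge_min lexx /= => /(_ isT) h.
apply: (le_trans h); rewrite mulrC -ler_pdivlMr//.
by rewrite ge_min lexx orbT.
Qed.

Hypothesis comm : forall p q : A, is_projection p -> is_projection q -> p * q = q * p.

(** Distinct projections of A have distance at least 1, so a distance tending to 0 forces equality
    on a set in U. *)
Lemma near_eq_projections p r (pP : forall n, is_projection (p n))
    (rP : forall n, is_projection (r n)) :
  up_projection pP = up_projection rP -> \forall n \near U, p n = r n.
Proof.
move=> /up_class_eq/cvgr0Pnorm_lt/(_ 1 ltr01); apply: filterS => n.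
by rewrite ger0_norm ?cnorm_ge0//; exact: projection_dist.
Qed.

Lemma up_projection_mul p r (pP : forall n, is_projection (p n))
    (rP : forall n, is_projection (r n)) :
  up_projection pP * up_projection rP =
  up_projection (fun n => projection_meet comm (pP n) (rP n)).
Proof. by rewrite up_class_mul; congr up_class; apply/val_inj. Qed.

Lemma up_projection0 : up_projection (fun=> @projection0 R A) = 0.
Proof. by rewrite -up_class0; congr up_class; apply/val_inj. Qed.

Variables (I : Type) (lt : I -> I -> Prop) (q : I -> A).
Hypothesis qP : forall a, is_projection (q a).

Definition up_const (a : I) : AU := up_projection (fun=> qP a).

(** Represent x by projections p n. Every sufficiently large a gives q a splitting p n, and
    countable boundedness yields one a for all n. If splitting failed in the ultrapower, p n would
    be 0 on a set in U. *)
Lemma ultrapower_splits :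
  (forall f : nat -> I, exists a, forall n, lt (f n) a) ->
  (forall p, is_projection p -> exists b, forall a, lt b a -> splits (q a) p) ->
  forall x : AU, star_projection x -> x <> 0 ->
  exists a, x * up_const a <> 0 /\ x * up_const a <> x.
Proof.
move=> bounded split_ex x /up_projection_lift[p [pP ->]] p0.
have /choice[f fP] n : exists b, forall a, lt b a -> splits (q a) (p n).
  exact: split_ex.
have [a fa] := bounded f; exists a.
have pn0 : ~ \forall n \near U, p n = 0.
  by move=> h; apply: p0; rewrite -up_projection0; apply: up_class_near.
rewrite up_projection_mul; split.
  rewrite -up_projection0 => /near_eq_projections h; apply: pn0.
  apply: filterS h => n h; apply: contrapT => pn.
  by have [] := fP n a (fa n) pn.
move=> /near_eq_projections h; apply: pn0.
apply: filterS h => n h; apply: contrapT => pn.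
by have [] := fP n a (fa n) pn.
Qed.

(** A bound for the family indexed by J * nat gives one a that works for all entries of all
    representing sequences. For each j the ultrafilter then selects one of the two alternatives. *)
Lemma ultrapower_decides (J : Type) :
  (forall f : J * nat -> I, exists a, forall n, lt (f n) a) ->
  (forall p, is_projection p -> exists b, forall a, lt b a -> decides (q a) p) ->
  forall x : J -> AU, (forall j, star_projection (x j)) ->
  inhabited J ->
  exists a, up_const a <> 0 /\
    forall j, x j * up_const a = up_const a \/ x j * up_const a = 0.
Proof.
move=> bounded decide_ex x xP [j0].
have /choice[p pP] j : exists p : nat -> A, exists pP : (forall n, is_projection (p n)),
  x j = up_projection pP by exact: up_projection_lift.
have pP' j n : is_projection (p j n) by have [] := pP j.
have {}pP j : x j = up_projection (pP' j).
  have [h ->] := pP j; congr up_projection; exact: Prop_irrelevance.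
have /choice[f fP] (jn : J * nat) : exists b, forall a, lt b a ->
    decides (q a) (p jn.1 jn.2) by exact: decide_ex.
have [a fa] := bounded f; exists a.
have dec j n : decides (q a) (p j n) := fP (j, n) a (fa (j, n)).
split.
  rewrite /up_const -up_projection0 => /near_eq_projections/filter_ex[n].
  by have [] := dec j0 n.
move=> j; rewrite pP up_projection_mul.
have [le|ne] := in_ultra_setVsetC [set n | p j n * q a = q a] FU.
  by left; apply: up_class_near; apply: filterS le.
right; rewrite -up_projection0; apply: up_class_near.
by apply: filterS ne => n /= ne; have [_ []] := dec j n.
Qed.

End UltrapowerProjections.

Theorem theorem4p2 (R : realType) (T : set (lsentence R))
    (T_cstar : theory_of_cstar T)
    (T_complete : complete_theory T)
    (proj_commute : forall A : cstarAlgType R, models (lstructure_of A) T ->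
      forall p q : A, is_projection p -> is_projection q -> p * q = q * p)
    (no_minimal_proj : forall A : cstarAlgType R, models (lstructure_of A) T ->
      forall p : A, is_projection p -> p <> 0 ->
        exists q : A, [/\ is_projection q, proj_lt 0 q & proj_lt q p])
    (not_CH : ~ continuum_hypothesis) :
  exists A B : cstarAlgType R,
    [/\ models (lstructure_of A) T, models (lstructure_of B) T,
        density_character_le A (set nat), density_character_le B (set nat) &
        forall (U V : set_system nat)
          (FU : UltraFilter U) (FV : UltraFilter V),
          nonprincipal U -> nonprincipal V ->
          ~ star_isomorphic (ultrapower A U) (ultrapower B V)].
Proof.
have [[M MT] _] := T_complete.
have [A0 MA] := T_cstar M MT.
have A0T : models (lstructure_of A0) T := models_iso MA MT.
have comm0 := proj_commute A0 A0T.
have [I1 [I2 [lt1 [lt2 [[[i1] [i2]] [sI1 sI2] [wf1 tr1 bd1] [wf2 tr2 bd2]]]]]] :=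
  two_cofinalities not_CH.
have [|A [W1 [ev1 [q1 [UW1 AT dA [sup1 gen1 q1P evq1] [n1 m1 s1]]]]]] :=
  @hull_model R T A0 I1 lt1 (fun p r => splits (sval r) (sval p)) T_cstar A0T
    (inhabits i1) sI1 wf1 tr1 bd1.
  move=> n p; have [r rP rp] := exists_splits comm0 (no_minimal_proj A0 A0T) n
    (fun i => svalP (p i)).
  by exists (exist _ r rP).
have [||B [W2 [ev2 [q2 [UW2 BT dB [sup2 gen2 q2P evq2] [n2 m2 s2]]]]]] :=
  @hull_model R T A0 I2 lt2 (fun p r => decides (sval r) (sval p)) T_cstar A0T
    (inhabits i2) sI2 wf2 tr2.
(* A sequence is a family on I1 * nat that ignores the first coordinate. *)
- move=> f; have [a fa] := bd2 (fun x => f x.2).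
  by exists a => n; exact: fa (i1, n).
- move=> n p; have [r rP rp] := exists_decides comm0 n (fun i => svalP (p i)).
  by exists (exist _ r rP).
have splitA := @generic_splits _ _ _ _ _ _ UW1 _ _ _ tr1 comm0 sup1 gen1 evq1 n1 m1 s1 (fun _ _ h => h).
have decideB := @generic_decides _ _ _ _ _ _ UW2 _ _ _ tr2 (proj_commute B BT) sup2 gen2 q2P evq2 n2 m2 s2
  (fun _ _ h => h).
exists A, B; split=> // U V FU FV _ _ [f [[g fK gK] f_star]].
have fM y z : f (y * z) = f y * f z by exact: rmorphM.
have f0 : f 0 = 0 by exact: rmorph0.
have f_proj x : star_projection x -> star_projection (f x).
  by move=> [sx xx]; split; [rewrite -f_star sx|rewrite -fM xx].
(* An isomorphism f carries the omega_1 constant projections to a family x, and some nonzero r is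
   split by no x j. Its preimage g r is then split by none of the constant projections, against
   [ultrapower_splits]. *)
pose x j : ultrapower B V := f (@up_const R A U FU I1 q1 q1P j).
have [||a [r0 rx]] := @ultrapower_decides R B V FV (proj_commute B BT) I2 lt2 q2 q2P I1
  bd2 decideB x; [by move=> j; apply/f_proj/up_projectionP|exact: inhabits i1|].
set r := @up_const R B V FV I2 q2 q2P a in r0 rx.
have [sr rr] : star_projection r by exact: up_projectionP.
have gr : star_projection (g r).
  split; apply: (can_inj fK); first by rewrite f_star gK.
  by rewrite fM !gK.
have gr0 : g r <> 0 by move=> h; apply: r0; rewrite -[r]gK h f0.
have [j [j1 j2]] := @ultrapower_splits R A U FU (proj_commute A AT) I1 lt1 q1 q1P
  bd1 splitA (g r) gr gr0.
have [sj _] : star_projection (@up_const R A U FU I1 q1 q1P j) by exact: up_projectionP.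
(* The two ultrapower lemmas put the factors in opposite orders; the adjoint exchanges them. *)
have swap : g r * @up_const R A U FU I1 q1 q1P j = star (@up_const R A U FU I1 q1 q1P j * g r).
  by rewrite starM sj gr.1.
have [h|h] := rx j.
- apply: j2; rewrite swap; have -> : @up_const R A U FU I1 q1 q1P j * g r = g r.
    by apply: (can_inj fK); rewrite fM !gK.
  exact: gr.1.
- apply: j1; rewrite swap; have -> : @up_const R A U FU I1 q1 q1P j * g r = 0.
    by apply: (can_inj fK); rewrite fM !gK f0.
  exact: star0.
Qed.
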